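(* Let $n$ be a positive integer and let $w\in S_n$. Then $$\frac{1}{2}\,|L_2(w)| = \operatorname{diam}(G(w))$$ if and only if $w$ is of the form $\mathrm{id}_i\oplus(\mathrm{id}_j\ominus \mathrm{id}_k)\oplus \mathrm{id}_\ell$ for some nonnegative integers $i,j,k,\ell$ (with $i+j+k+\ell=n$).
   Context: Direct and skew sums: for permutations in one-line notation $w=w_1\cdots w_n\in S_n$ and $u=u_1\cdots u_m\in S_m$, the direct sum $w\oplus u\in S_{n+m}$ is $w_1\cdots w_n(n+u_1)\cdots(n+u_m)$, and the skew sum $w\ominus u\in S_{n+m}$ is the permutation in which the entries of $w$, all shifted up by $m$, come first, followed by $u$: $(m+w_1)\cdots(m+w_n)u_1\cdots u_m$. $\mathrm{id}_n$ is the identity permutation in $S_n$ ($\mathrm{id}_0$ is the empty permutation). The symmetric group $S_n$ is the Coxeter group (type $A_{n-1}$) generated by the adjacent transpositions $s_1,\dots,s_{n-1}$, $s_i=(i\ \ i{+}1)$, with $m_{ij}$ the order of $s_is_j$. A reduced word of $w$ is an expression $s_{i_1}\cdots s_{i_\ell}$ of $w$ of minimal length. Graph $G(w)$: the vertices are the reduced words of $w$. Two reduced words are joined by an edge when they differ by a single application of one of the Coxeter relations $s_is_j\cdots = s_js_i\cdots$ ($m_{ij}$ letters on each side, $i\ne j$), replacing a consecutive factor. This graph is connected. $\operatorname{diam}(G(w))$ is the maximum graph distance between two of its vertices. Set $L_2(w)$: let $\Phi^+=\{e_j-e_i : 1\le i<j\le n\}$ be the positive roots. The Coxeter arrangement $\mathcal{A}$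 consists of the hyperplanes $H_\alpha=\{x:\langle x,\alpha\rangle=0\}$, $\alpha\in\Phi^+$ (in $\mathbb{R}^n$, or in the hyperplane of vectors with coordinate sum zero, so as to make the arrangement essential). Its chambers are the connected components of the complement of the union of the hyperplanes. They are labelled by elements of $S_n$: the identity labels the fundamental chamber $C=\{x:\langle x,\alpha\rangle>0\ \forall\alpha\in\Phi^+\}$, and $w$ labels $wC$. Let $L_2$ be the set of codimension-two subspaces that are intersections of hyperplanes in $\mathcal{A}$. Then $L_2(w)$ is the set of $X\in L_2$ such that the images of the chambers $C$ and $wC$ in the localized arrangement $\mathcal{A}_X=\{H/X : H\in\mathcal{A},\ H\supset X\}$ are antipodal (i.e. every hyperplane $H\in\mathcal{A}$ with $H\supset X$ separates $C$ from $wC$). *)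

(* Defs.v *)
From mathcomp Require Import all_boot all_order all_algebra all_fingroup.
From mathcomp Require Import finmap boolp classical_sets cardinality reals.

Set Implicit Arguments.
Unset Strict Implicit.
Unset Printing Implicit Defensive.

Import Order.TTheory GRing.Theory Num.Theory.

Local Open Scope classical_set_scope.

Lemma dsum_inj n m (w : 'S_n) (u : 'S_m) :
  injective (fun x : 'I_(n + m) =>
    match split x with
    | inl i => lshift m (w i)
    | inr j => rshift n (u j)
    end).
Proof.
move=> x y /=; case: (split_ordP x) => i ->; case: (split_ordP y) => j ->.
- by move/lshift_inj/perm_inj->.
- by move/eqP; rewrite eq_lrshift.
- by move/eqP; rewrite eq_rlshift.
- by move/rshift_inj/perm_inj->.
Qed.

Definition direct_sum n m (w : 'S_n) (u : 'S_m) : 'S_(n + m) :=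
  perm (@dsum_inj n m w u).

Lemma ssum_inj n m (w : 'S_n) (u : 'S_m) :
  injective (fun x : 'I_(n + m) => cast_ord (addnC m n)
    match split x with
    | inl i => rshift m (w i)
    | inr j => lshift n (u j)
    end).
Proof.
move=> x y /= /cast_ord_inj.
case: (split_ordP x) => i ->; case: (split_ordP y) => j ->.
- by move/rshift_inj/perm_inj->.
- by move/eqP; rewrite eq_rlshift.
- by move/eqP; rewrite eq_lrshift.
- by move/lshift_inj/perm_inj->.
Qed.

Definition skew_sum n m (w : 'S_n) (u : 'S_m) : 'S_(n + m) :=
  perm (@ssum_inj n m w u).

Definition id_perm n : 'S_n := 1%g.

(* [xget] returns the default value 0 when the set has no minimum (that is,
   when it is empty), resp. no maximum. *)
Definition nat_min (A : set nat) : nat :=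
  xget 0 [set m | A m /\ forall k, A k -> m <= k].

Definition nat_max (A : set nat) : nat :=
  xget 0 [set m | A m /\ forall k, A k -> k <= m].

Definition graph_dist (T : Type) (e : rel T) (x y : T) : nat :=
  nat_min [set k | exists p : seq T, [/\ path e x p, last x p = y & size p = k]].

(* Meaningful for a nonempty finite vertex set [V] that is connected under
   [e]; graphs of reduced words are always of this kind. *)
Definition graph_diam (T : Type) (V : set T) (e : rel T) : nat :=
  nat_max [set d | exists x y, [/\ V x, V y & d = graph_dist e x y]].

Lemma ltn_ord_pred n (i : 'I_n.-1) : i.+1 < n.
Proof. by rewrite -ltn_predRL. Qed.

(* The generators are numbered from 0: [simple_refl i] exchanges the values
   i and i + 1 of [0, ..., n - 1]. *)
Definition simple_refl n (i : 'I_n.-1) : 'S_n :=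
  tperm (widen_ord (leq_pred n) i) (Ordinal (ltn_ord_pred i)).

Definition coxeter_m n (i j : 'I_n.-1) : nat :=
  #[simple_refl i * simple_refl j]%g.

(* In MathComp [(s * t)%g] applies [s] first. The word is reversed so that
   [word_perm [:: i1; ...; ik]] is the composite function
   s_i1 \o ... \o s_ik, compatibly with the left action [perm_act] below. *)
Definition word_perm n (u : seq 'I_n.-1) : 'S_n :=
  (\prod_(i <- rev u) simple_refl i)%g.

Definition reduced_words n (w : 'S_n) : set (seq 'I_n.-1) :=
  [set u | word_perm u = w /\ forall v, word_perm v = w -> size u <= size v].

Definition alternating (T : Type) (x y : T) (m : nat) : seq T :=
  mkseq (fun k => if odd k then y else x) m.

Definition coxeter_move n (u v : seq 'I_n.-1) : Prop :=
  exists (a b : seq 'I_n.-1) (i j : 'I_n.-1),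
    [/\ i != j,
        u = a ++ alternating i j (coxeter_m i j) ++ b &
        v = a ++ alternating j i (coxeter_m i j) ++ b].

Definition G_edge n (w : 'S_n) : rel (seq 'I_n.-1) :=
  fun u v => `[< [/\ reduced_words w u, reduced_words w v & coxeter_move u v] >].

Definition diam_G n (w : 'S_n) : nat :=
  graph_diam (reduced_words w) (G_edge w).

Local Open Scope ring_scope.

Definition dot (R : realType) n (x y : 'rV[R]_n) : R := (x *m y^T) 0 0.

Definition hyperplane (R : realType) n (a : 'rV[R]_n) : {vspace 'rV[R]_n} :=
  lker (linfun (mulmxr a^T : 'rV[R]_n -> 'rV[R]_1)).

Lemma mem_hyperplane (R : realType) n (a x : 'rV[R]_n) :
  (x \in hyperplane a) = (dot x a == 0).
Proof.
rewrite memv_ker lfunE /= /dot; apply/eqP/eqP => [->|h]; first by rewrite mxE.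
by apply/rowP => i; rewrite !ord1 h mxE.
Qed.

(* The pair [(i, j)] with i < j indexes the positive root e_j - e_i. *)
Definition positive_root n : {set 'I_n * 'I_n} :=
  [set p : 'I_n * 'I_n | (p.1 < p.2)%N]%SET.

Definition type_A_root (R : realType) n (p : 'I_n * 'I_n) : 'rV[R]_n :=
  delta_mx 0 p.2 - delta_mx 0 p.1.

(* The linear action with w e_i = e_(w i), i.e. (w x)_(w i) = x_i. *)
Definition perm_act (R : realType) n (w : 'S_n) (x : 'rV[R]_n) : 'rV[R]_n :=
  col_perm w^-1%g x.

Definition fundamental_chamber (R : realType) n : set 'rV[R]_n :=
  [set x | forall p, p \in positive_root n -> 0 < dot x (type_A_root R p)].
Arguments fundamental_chamber R n : clear implicits.

Definition chamber (R : realType) n (w : 'S_n) : set 'rV[R]_n :=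
  perm_act w @` fundamental_chamber R n.
Arguments chamber R {n} w.

(* [A] and [B] lie in opposite open half-spaces of the hyperplane [a]^perp. *)
Definition separates (R : realType) n (a : 'rV[R]_n) (A B : set 'rV[R]_n) :=
  forall x y, A x -> B y -> dot x a * dot y a < 0.

Definition L2 (R : realType) n : set {vspace 'rV[R]_n} :=
  [set X | (exists2 S : {set 'I_n * 'I_n}, S \subset positive_root n &
             X = (\bigcap_(p in S) hyperplane (type_A_root R p))%VS)
           /\ (\dim X + 2 = n)%N].
Arguments L2 R n : clear implicits.

Definition L2_of (R : realType) n (w : 'S_n) : set {vspace 'rV[R]_n} :=
  [set X | L2 R n X /\
     forall p, p \in positive_root n -> (X <= hyperplane (type_A_root R p))%VS ->
       separates (type_A_root R p) (fundamental_chamber R n) (chamber R w)].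
Arguments L2_of R {n} w.

Lemma finite_L2_of (R : realType) n (w : 'S_n) : finite_set (L2_of R w).
Proof.
apply: (@sub_finite_set _ _
  ((fun S : {set 'I_n * 'I_n} => (\bigcap_(p in S) hyperplane (type_A_root R p))%VS)
     @` setT)); last exact/finite_image/finite_finset.
by move=> X [[[S _ ->] _] _]; exists S.
Qed.

(* [fset_set] returns the empty set on infinite sets; see [finite_L2_of]. *)
Definition card_L2_of (R : realType) n (w : 'S_n) : nat :=
  #|` fset_set (L2_of R w)|%fset.

(* Main.v *)
Require Import Defs.
From mathcomp Require Import all_boot all_order all_algebra all_fingroup.
From mathcomp Require Import reals.
From mathcomp Require Import cyclic boolp finmap zify.
From mathcomp Require classical_sets cardinality.

(** A subspace in [L2_of w] is cut out by two inversions of [w] that share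
    neither their smaller nor their larger value: either they are disjoint, or
    they are (a, b) and (b, c), in which case (a, c) is an inversion too and the
    subspace lies on three hyperplanes.  So |L_2(w)| is the number of such flip
    pairs ([card_L2_ofE]).

    Reading a reduced word letter by letter creates the inversions of [w] one at
    a time, hence a reduced word is a linear order on the inversions.  A
    commutation or braid move reverses the relative order of the two members of
    exactly one flip pair, so the distance between two reduced words is at least
    the number of flip pairs that they order differently ([flipped_le_dist]).
    This needs a path to exist, which is Matsumoto's theorem
    ([reduced_linked]).

    Lower bound.  Sorting the inversions by the larger value, by the smaller
    value, by the position of the larger value or by the position of the smaller
    value gives, with suitable directions and tie-breaks, four reduced words
    ([four_reduced_words]).  A flip pair x, y with x.2 < y.2 is ordered
    differently by the first two words iff x.1 < y.1, and by the last two iff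
    exactly one of the following holds in one-line notation: y.2 precedes x.2,
    x.1 precedes y.1.  A pair satisfying neither condition consists of the two
    nested inversions in a pattern 3412 or 4321; by exchanging smaller values it
    is sent injectively to a pair satisfying both ([swap_lowers_defect]).
    Therefore the two distances add up to at least |L_2(w)|, and one of them is at least half of it
    ([half_flip_pairs_le_diam]).

    Equality.  If the diameter is exactly half of |L_2(w)|, this injection is
    onto, which excludes the patterns 321, 2143, 3142 and 2413.  Then the
    smaller value of any inversion forms an inversion with the larger value of
    any other ([extremal_biclique]), the inversions form a rectangle
    ([biclique_rectangle]), and since the inversions determine the permutation,
    [w] is a block permutation as in the statement ([biclique_block]).

    Conversely, when the inversions form a rectangle, two inversions sharing a
    value, as well as two nested ones, occur in the same order in all reduced
    words.  Only commutations are ever applied, bubble sort turns one reduced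
    word into another with one move for each flip pair ordered differently
    ([dist_le_flipped]), and the pairs that can be ordered differently make up
    at most half of the flip pairs ([increase_le_half]). *)

Set Implicit Arguments.
Unset Strict Implicit.
Unset Printing Implicit Defensive.

Import Order.TTheory GRing.Theory Num.Theory.

(** * Inversions and generators *)

Section Inversions.
Context (n : nat).
Implicit Types (w p : 'S_n) (i j : 'I_n.-1) (u v : seq 'I_n.-1).

Definition left_pos i : 'I_n := widen_ord (leq_pred n) i.
Definition right_pos i : 'I_n := Ordinal (ltn_ord_pred i).

(** Inversions are pairs of values, not of positions: with this choice (a, b) is an
    inversion of [w] iff the hyperplane orthogonal to e_b - e_a separates the
    fundamental chamber from its image under [w]. *)
Definition inversions w : {set 'I_n * 'I_n} :=
  [set x : 'I_n * 'I_n | (x.1 < x.2) && (w^-1%g x.2 < w^-1%g x.1)]%SET.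

Lemma val_simple_refl i (x : 'I_n) :
  simple_refl i x =
    (if x == i :> nat then i.+1 else if x == i.+1 :> nat then i : nat else x) :> nat.
Proof.
rewrite /simple_refl permE /= -!val_eqE /=.
by case: eqP => // _; case: eqP.
Qed.

Lemma simple_refl_lt i (x y : 'I_n) :
  (simple_refl i x < simple_refl i y) =
    if (x == i :> nat) && (y == i.+1 :> nat) then false
    else if (x == i.+1 :> nat) && (y == i :> nat) then true else x < y.
Proof. rewrite !val_simple_refl; (do !case: ifP) => /=; lia. Qed.

Lemma simple_reflK i p : (simple_refl i * (simple_refl i * p) = p)%g.
Proof. by rewrite mulgA tperm2 mul1g. Qed.

Lemma refl_mulE i p x : (simple_refl i * p)%g x = p (simple_refl i x).
Proof. by rewrite permM. Qed.

Lemma refl_mulVE i p x : (simple_refl i * p)^-1%g x = simple_refl i (p^-1%g x).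
Proof. by rewrite invMg tpermV permM. Qed.

Lemma refl_left i : simple_refl i (left_pos i) = right_pos i.
Proof. exact: tpermL. Qed.

Lemma refl_right i : simple_refl i (right_pos i) = left_pos i.
Proof. exact: tpermR. Qed.

(** Exchanging two neighbouring entries changes the relative position of no other
    pair of values. *)
Lemma inversions_refl p i : p (left_pos i) < p (right_pos i) ->
  inversions (simple_refl i * p)%g = ((p (left_pos i), p (right_pos i)) |: inversions p)%SET.
Proof.
move=> asc; apply/setP => -[a b]; rewrite !inE /= !refl_mulVE simple_refl_lt.
rewrite xpair_eqE.
have L c : (c == p (left_pos i)) = (p^-1%g c == i :> nat).
  by rewrite eq_sym -(inj_eq (@perm_inj _ p^-1%g)) permK eq_sym.
have H c : (c == p (right_pos i)) = (p^-1%g c == i.+1 :> nat).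
  by rewrite eq_sym -(inj_eq (@perm_inj _ p^-1%g)) permK eq_sym.
rewrite -!L -!H.
have [->|aL] := eqVneq a (p (left_pos i)); have [->|bH] := eqVneq b (p (right_pos i)) => /=.
- by rewrite asc /=; case: eqP => // e; move: asc; rewrite e ltnn.
- by have [->|bL] := eqVneq b (p (left_pos i)); rewrite ?ltnn.
- by have [->|aH] := eqVneq a (p (right_pos i)); rewrite ?ltnn ?andbF.
- case: ifP => // /andP[/eqP-> /eqP->]; rewrite !permK /=; lia.
Qed.

Lemma new_inversionN p i : p (left_pos i) < p (right_pos i) ->
  (p (left_pos i), p (right_pos i)) \notin inversions p.
Proof. by move=> asc; rewrite inE /= !permK /= asc /=; lia. Qed.

Lemma card_inversions_refl p i : p (left_pos i) < p (right_pos i) ->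
  #|inversions (simple_refl i * p)%g| = #|inversions p|.+1.
Proof. by move=> asc; rewrite inversions_refl // cardsU1 new_inversionN. Qed.

Lemma ascent_or_descent p i :
  (p (left_pos i) < p (right_pos i)) || (p (right_pos i) < p (left_pos i)).
Proof.
rewrite -neq_ltn val_eqE (inj_eq perm_inj) -val_eqE /=; lia.
Qed.

(** The inversions tell which of two values comes first, and the position of a
    value is the number of values that precede it. *)
Lemma inversions_inj : injective inversions.
Proof.
move=> p q E.
have lt_pos a b : (p^-1%g a < p^-1%g b) = (q^-1%g a < q^-1%g b).
  have key (r : 'S_n) (c d : 'I_n) : c < d -> (r^-1%g c < r^-1%g d) = ((c, d) \notin inversions r).
    move=> cd; rewrite inE /= cd /=.
    have : r^-1%g c != r^-1%g d by rewrite (inj_eq perm_inj) -val_eqE /=; lia.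
    rewrite -val_eqE /=; lia.
  have [ab|ba|/val_inj->] := ltngtP a b; last by rewrite !ltnn.
    by rewrite !key // E.
  have kk := key _ _ _ ba.
  have N (r : 'S_n) : (r^-1%g a < r^-1%g b) = ~~ (r^-1%g b < r^-1%g a).
    have : r^-1%g a != r^-1%g b by rewrite (inj_eq perm_inj) -val_eqE /=; lia.
    rewrite -val_eqE /=; lia.
  by rewrite !N !kk E.
have pos_card (r : 'S_n) a : #|[set c | r^-1%g c < r^-1%g a]%SET| = r^-1%g a :> nat.
  have -> : [set c | r^-1%g c < r^-1%g a]%SET = (r @: [set c : 'I_n | c < r^-1%g a])%SET.
    apply/setP => c; rewrite inE; apply/idP/imsetP => [lt|[d]].
      by exists (r^-1%g c); rewrite ?inE ?permKV.
    by rewrite inE => lt ->; rewrite permK.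
  rewrite card_imset; last exact: perm_inj.
  rewrite -sum1dep_card -(big_ord_widen n (fun=> 1)); last exact/ltnW/ltn_ord.
  by rewrite sum1_card card_ord.
apply: invg_inj; apply/permP => a; apply: val_inj => /=.
rewrite -(pos_card p) -[RHS](pos_card q); apply: eq_card => c; by rewrite !inE lt_pos.
Qed.

End Inversions.

(** * Reduced words as orders on the inversions *)

Section Words.
Context (n : nat).
Implicit Types (w p : 'S_n) (i j : 'I_n.-1) (u v : seq 'I_n.-1).

Lemma inversions1 : inversions (1 : 'S_n)%g = set0%SET.
Proof. by apply/setP => x; rewrite !inE !invg1 !perm1; lia. Qed.

Lemma inversions_refl_desc w i : w (right_pos i) < w (left_pos i) ->
  inversions w = ((w (right_pos i), w (left_pos i)) |: inversions (simple_refl i * w)%g)%SET.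
Proof.
move=> desc; rewrite -{1}(simple_reflK i w) inversions_refl !refl_mulE refl_left refl_right //.
Qed.

Lemma removed_inversionN w i : w (right_pos i) < w (left_pos i) ->
  (w (right_pos i), w (left_pos i)) \notin inversions (simple_refl i * w)%g.
Proof.
move=> desc; have := @new_inversionN _ (simple_refl i * w)%g i.
by rewrite !refl_mulE refl_left refl_right; apply.
Qed.

(** Both properties that follow express that the inversions and the
    non-inversions are each closed under addition of roots. *)
Lemma inversion_split w (a b c : 'I_n) : a < b < c -> (a, c) \in inversions w ->
  ((a, b) \in inversions w) || ((b, c) \in inversions w).
Proof.
rewrite !inE /= => /andP[ab bc] /andP[_ ac]; rewrite ab bc /=.
have := ltn_ord b; lia.
Qed.

Lemma inversion_trans w (a b c : 'I_n) :
  (a, b) \in inversions w -> (b, c) \in inversions w -> (a, c) \in inversions w.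
Proof. rewrite !inE /=; lia. Qed.

Lemma word_perm_nil : word_perm [::] = 1%g :> 'S_n.
Proof. by rewrite /word_perm big_nil. Qed.

Lemma word_perm_cat u v : word_perm (u ++ v) = (word_perm v * word_perm u)%g.
Proof. by rewrite /word_perm rev_cat big_cat. Qed.

Lemma word_perm_rcons u i : word_perm (rcons u i) = (simple_refl i * word_perm u)%g.
Proof. by rewrite -cats1 word_perm_cat /word_perm /= big_seq1. Qed.

Lemma word_perm_cons u i : word_perm (i :: u) = (word_perm u * simple_refl i)%g.
Proof. by rewrite -cat1s word_perm_cat /word_perm /= big_seq1. Qed.

(** The values exchanged by the successive letters of [u] in one-line notation,
    starting from [p].  For [p] the identity and [u] reduced this is the root
    sequence of [u]: the walls crossed by the gallery of [u], in order. *)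
Fixpoint swaps p u : seq ('I_n * 'I_n) :=
  if u is i :: u' then
    (p (left_pos i), p (right_pos i)) :: swaps (simple_refl i * p)%g u'
  else [::].

Lemma swaps_cat p u v : swaps p (u ++ v) = swaps p u ++ swaps (word_perm u * p)%g v.
Proof.
elim: u p => [|i u IH] p /=; first by rewrite word_perm_nil mul1g.
by rewrite IH word_perm_cons mulgA.
Qed.

Definition inv_seq u := swaps 1%g u.

Lemma inv_seq_rcons u i :
  inv_seq (rcons u i) = rcons (inv_seq u) (word_perm u (left_pos i), word_perm u (right_pos i)).
Proof. by rewrite -cats1 /inv_seq swaps_cat /= cats1 mulg1. Qed.

Lemma size_inv_seq u : size (inv_seq u) = size u.
Proof. by elim/last_ind: u => // u i IH; rewrite inv_seq_rcons !size_rcons IH. Qed.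

(** The length of [w] is its number of inversions, so this is the decidable form of
    [reduced_words] (see [reduced_wordsP]). *)
Definition reduced w u := (word_perm u == w) && (size u == #|inversions w|).

Lemma card_inversions_word u : #|inversions (word_perm u)| <= size u.
Proof.
elim/last_ind: u => [|u i IH]; first by rewrite word_perm_nil inversions1 cards0.
rewrite word_perm_rcons size_rcons.
have /orP[asc|desc] := ascent_or_descent (word_perm u) i; first by rewrite card_inversions_refl.
by move: IH; rewrite {1}(inversions_refl_desc desc) cardsU1 removed_inversionN //; lia.
Qed.

(** Each letter changes the number of inversions by one, so no letter of a reduced
    word may remove an inversion. *)
Lemma reduced_rcons w u i :
  reduced w (rcons u i) = (w (right_pos i) < w (left_pos i)) && reduced (simple_refl i * w)%g u.
Proof.
rewrite /reduced word_perm_rcons size_rcons.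
have -> : ((simple_refl i * word_perm u)%g == w) = (word_perm u == (simple_refl i * w)%g).
  by apply/eqP/eqP => [<-|->]; rewrite simple_reflK.
case: eqP => [e|]; last by rewrite andbF.
have /orP[asc|desc] := ascent_or_descent w i.
  have := card_inversions_word u; rewrite e card_inversions_refl //=; lia.
rewrite desc [in LHS](inversions_refl_desc desc) cardsU1 removed_inversionN //=.
Qed.

Lemma reduced_word_perm w u : reduced w u -> word_perm u = w.
Proof. by case/andP => /eqP. Qed.

Lemma mem_inv_seq w u : reduced w u -> inv_seq u =i inversions w.
Proof.
elim/last_ind: u w => [|u i IH] w.
  by move=> /reduced_word_perm <- x; rewrite word_perm_nil inversions1 !inE.
rewrite reduced_rcons => /andP[desc red] x.
rewrite (inversions_refl_desc desc) inv_seq_rcons mem_rcons !inE (IH _ red).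
by rewrite (reduced_word_perm red) !refl_mulE refl_left refl_right !inE.
Qed.

Lemma inv_seq_uniq w u : reduced w u -> uniq (inv_seq u).
Proof.
move=> red; apply/card_uniqP; rewrite size_inv_seq (eq_card (mem_inv_seq red)).
by case/andP: red => _ /eqP.
Qed.

Definition before u : rel ('I_n * 'I_n) :=
  fun x y => index x (inv_seq u) < index y (inv_seq u).

Lemma index_rcons (T : eqType) (x z : T) s :
  x \in s -> index x (rcons s z) = index x s.
Proof. by move=> xs; rewrite -cats1 index_cat xs. Qed.

Lemma index_rcons_last (T : eqType) (z : T) s :
  z \notin s -> index z (rcons s z) = size s.
Proof. by move=> /negbTE zs; rewrite -cats1 index_cat zs /= eqxx addn0. Qed.

(** When (a, c) is created, b stands on one side of the neighbours a and c, so it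
    has already been exchanged with one of them. *)
Lemma before_between w u (a b c : 'I_n) : reduced w u -> a < b < c ->
    (a, c) \in inversions w ->
  ((a, b) \in inversions w) && before u (a, b) (a, c) ||
  ((b, c) \in inversions w) && before u (b, c) (a, c).
Proof.
move=> + abc; elim/last_ind: u w => [|u i IH] w.
  by move=> /reduced_word_perm <-; rewrite word_perm_nil inversions1 !inE.
rewrite reduced_rcons => /andP[desc red] acw.
have split := inversion_split abc acw.
set m := (w (right_pos i), w (left_pos i)).
have Em : inv_seq (rcons u i) = rcons (inv_seq u) m.
  by rewrite inv_seq_rcons (reduced_word_perm red) !refl_mulE refl_left refl_right.
have Ew x : (x \in inversions w) = (x == m) || (x \in inv_seq u).
  by rewrite (inversions_refl_desc desc) !inE (mem_inv_seq red) inE.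
have mN : m \notin inv_seq u by rewrite (mem_inv_seq red) removed_inversionN.
rewrite /before Em.
have [acu|acN] := boolP ((a, c) \in inv_seq u).
  have := IH _ red; rewrite -(mem_inv_seq red) => /(_ acu).
  rewrite !Ew => /orP[]/andP[]; rewrite -(mem_inv_seq red) /before => xu lt.
    by rewrite (index_rcons _ xu) (index_rcons _ acu) xu orbT lt.
  by rewrite (index_rcons _ xu) (index_rcons _ acu) xu lt !orbT.
have em : (a, c) = m by move: acw; rewrite Ew (negbTE acN) orbF => /eqP.
have key x : x \in inversions w -> x != (a, c) ->
    index x (rcons (inv_seq u) m) < index (a, c) (rcons (inv_seq u) m).
  rewrite Ew em => /orP[->//|xu] _.
  by rewrite index_rcons // index_rcons_last // index_mem.
have [ab bc] := andP abc.
case/orP: split => h.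
  by rewrite h key // xpair_eqE eqxx -val_eqE /= ltn_eqF.
by apply/orP; right; rewrite h key // xpair_eqE -val_eqE /= gtn_eqF.
Qed.

(** The orders that reduced words induce on the inversions: the root e_c - e_a is
    the sum of e_b - e_a and e_c - e_b, and must come between them.  A summand
    that is not an inversion counts as coming after everything. *)
Definition convex_key w (f : 'I_n * 'I_n -> nat) :=
  forall a b c : 'I_n, a < b < c -> (a, c) \in inversions w ->
    [&& (a, b) \in inversions w, f (a, b) < f (a, c)
      & ((b, c) \in inversions w) ==> (f (a, c) < f (b, c))] ||
    [&& (b, c) \in inversions w, f (b, c) < f (a, c)
      & ((a, b) \in inversions w) ==> (f (a, c) < f (a, b))].

(** An entry c strictly between the entries b and a in [w] would form, with a, b
    and c, a root sum in which (a, b) is a proper summand of an inversion or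
    lies between two inversions; convexity then puts another inversion after
    (a, b). *)
Lemma max_inversion_adjacent w f (a b : 'I_n) : convex_key w f ->
    (a, b) \in inversions w -> (forall y, y \in inversions w -> f y <= f (a, b)) ->
  exists i, (a, b) = (w (right_pos i), w (left_pos i)).
Proof.
move=> conv abw max.
have := abw; rewrite inE /= => /andP[ab pba].
have adj : (w^-1%g b).+1 = w^-1%g a.
  apply/eqP; rewrite eqn_leq pba /= leqNgt; apply/negP => gap.
  have cn : (w^-1%g b).+1 < n by apply: leq_ltn_trans pba (ltn_ord _).
  pose c := w (Ordinal cn).
  have pc : w^-1%g c = (w^-1%g b).+1 :> nat by rewrite permK.
  (* The entry that immediately follows b is placed in turn below a, between
     a and b, and above b. *)
  have [ca|ac|/val_inj eac] := ltngtP c a; last by move: pc gap; rewrite eac; lia.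
    have cbw : (c, b) \in inversions w by rewrite inE /=; lia.
    have caw : (c, a) \in inversions w = false by rewrite inE /=; lia.
    have := conv c a b; rewrite ca ab caw /= => /(_ isT cbw) /and3P[_ lt _].
    by move: (max _ cbw); rewrite leqNgt lt.
  have [cb|bc|/val_inj ecb] := ltngtP c b; last by move: pc; rewrite ecb; lia.
    have acw : (a, c) \in inversions w by rewrite inE /=; lia.
    have cbw : (c, b) \in inversions w by rewrite inE /=; lia.
    have := conv a c b; rewrite ac cb acw cbw abw /= => /(_ isT isT).
    by case/orP => /andP[_ lt]; [move: (max _ cbw)|move: (max _ acw)]; rewrite leqNgt lt.
  have acw : (a, c) \in inversions w by rewrite inE /=; lia.
  have bcw : (b, c) \in inversions w = false by rewrite inE /=; lia.
  have := conv a b c; rewrite bc ab bcw acw abw /= => /(_ isT isT).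
  by rewrite orbF andbT => lt; move: (max _ acw); rewrite leqNgt lt.
have lti : w^-1%g b < n.-1 by have := ltn_ord (w^-1%g a); lia.
exists (Ordinal lti); congr pair.
  by rewrite -[LHS](permKV w); congr (w _); apply: val_inj; rewrite /= adj.
by rewrite -[LHS](permKV w); congr (w _); apply: val_inj.
Qed.

(** The last inversion in the given order is an adjacent descent of [w]; undoing it
    leaves a permutation with one inversion fewer, on which the order is still
    convex.  Hence every convex order is the order of a reduced word. *)
Lemma exists_sorted_word w f : {in inversions w &, injective f} -> convex_key w f ->
  exists2 u, reduced w u & {in inversions w &, forall x y, before u x y = (f x < f y)}.
Proof.
move: {2}#|_| (erefl #|inversions w|) => N; elim: N w => [|N IH] w cardw inj conv.
  have w0 : inversions w = set0%SET by apply/eqP; rewrite -cards_eq0 cardw.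
  have -> : w = 1%g by apply: inversions_inj; rewrite inversions1.
  exists [::]; first by rewrite /reduced word_perm_nil inversions1 cards0 !eqxx.
  by move=> x y; rewrite inversions1 inE.
have [x0 x0w] : exists x, x \in inversions w by apply/card_gt0P; rewrite cardw.
have [m mw max] : exists2 m, m \in inversions w &
    forall y, y \in inversions w -> f y <= f m.
  by have [m mw max] := arg_maxnP f x0w; exists m.
have [i em] : exists i, m = (w (right_pos i), w (left_pos i)).
  by case: m mw max => a b; apply: max_inversion_adjacent.
have desc : w (right_pos i) < w (left_pos i) by move: mw; rewrite em inE /= => /andP[].
set p : 'S_n := (simple_refl i * w)%g.
have Ew : inversions w = (m |: inversions p)%SET by rewrite em -inversions_refl_desc.
have mp : m \notin inversions p by rewrite em removed_inversionN.
have pw x : x \in inversions p -> x \in inversions w by rewrite Ew in_setU1 orbC => ->.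
have lt_max x : x \in inversions p -> f x < f m.
  move=> xp; rewrite ltn_neqAle max ?pw // andbT; apply: contra mp => /eqP e.
  by rewrite -(inj _ _ (pw _ xp) mw e).
have cardp : #|inversions p| = N by move: cardw; rewrite Ew cardsU1 mp; lia.
have [|a b c abc acp|u red bu] := IH p cardp.
- by move=> x y xp yp; apply: inj; apply: pw.
- have := conv a b c abc (pw _ acp); rewrite Ew !in_setU1.
  move: mp (lt_max _ acp).
  (* Deleting the maximum m agrees with the convention that missing inversions
     come last, whether or not m is one of the two summands. *)
  case: eqP => [<-|_]; case: eqP => [<-|_] /=.
  + by move/negbTE->; move: (f (a, b)) (f (a, c)) (f (b, c)) => x y z; lia.
  + by move/negbTE->; move: (f (a, b)) (f (a, c)) (f (b, c)) (_ \in _) => x y z B; lia.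
  + by move/negbTE->; move: (f (a, b)) (f (a, c)) (f (b, c)) (_ \in _) => x y z B; lia.
  + by [].
have Em : inv_seq (rcons u i) = rcons (inv_seq u) m.
  by rewrite inv_seq_rcons (reduced_word_perm red) !refl_mulE refl_left refl_right em.
exists (rcons u i); first by rewrite reduced_rcons desc.
have mu : m \notin inv_seq u by rewrite (mem_inv_seq red).
move=> x y; rewrite Ew !in_setU1 /before Em -!(mem_inv_seq red).
case/predU1P => [->|xu]; case/predU1P => [->|yu].
- by rewrite !ltnn.
- rewrite index_rcons_last // index_rcons //; apply/esym.
  have := lt_max y; rewrite -(mem_inv_seq red) => /(_ yu).
  by move: yu; rewrite -index_mem; lia.
- rewrite index_rcons_last // index_rcons // index_mem xu lt_max //.
  by rewrite -(mem_inv_seq red).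
- by rewrite !index_rcons // -bu -?(mem_inv_seq red).
Qed.

End Words.

(** * Four reduced words *)

Section Keys.
Context (n : nat).
Implicit Types (w p : 'S_n) (x y : 'I_n * 'I_n).

(** The lexicographic order of pairs of numbers at most [n], encoded in one number. *)
Definition lex (p q : nat) := p * n.+1 + q.

Lemma lex_lt (p q p' q' : nat) : q <= n -> q' <= n ->
  (lex p q < lex p' q') = (p < p') || (p == p') && (q < q').
Proof.
rewrite /lex => qn qn'; have [lt|gt|->] := ltngtP p p'; last by rewrite ltn_add2l.
  by have : p.+1 * n.+1 <= p' * n.+1 by [rewrite leq_mul2r lt orbT]; rewrite mulSn; lia.
by have : p'.+1 * n.+1 <= p * n.+1 by [rewrite leq_mul2r gt orbT]; rewrite mulSn; lia.
Qed.

Lemma lex_inj (p q p' q' : nat) : q <= n -> q' <= n -> lex p q = lex p' q' -> p = p' /\ q = q'.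
Proof.
move=> qn qn' e; have := lex_lt p p' qn qn'; have := lex_lt p' p qn' qn.
by rewrite e !ltnn; lia.
Qed.

(** For an inversion (a, b), a is its lower and b its upper value.  The four keys
    correspond to insertion sorts that bring the values to their final places
    one after another.  In each of them the tie-break is forced by
    convexity. *)
Definition key_upper_value w x := lex x.2 (n - w^-1%g x.1).
Definition key_lower_value w x := lex (n - x.1) (w^-1%g x.2).
Definition key_upper_position w x := lex (w^-1%g x.2) (n - x.1).
Definition key_lower_position w x := lex (n - w^-1%g x.1) x.2.

(** For a < b < c each key is checked on the possible positions of b relative to
    those of c and a. *)
Lemma convex_keys w : [/\ convex_key w (key_upper_value w), convex_key w (key_lower_value w),
  convex_key w (key_upper_position w) & convex_key w (key_lower_position w)].
Proof.
split=> a b c /andP[ab bc];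
  rewrite /key_upper_value /key_lower_value /key_upper_position /key_lower_position /=;
  rewrite !lex_lt ?leq_subr ?(ltnW (ltn_ord _)) // !inE /=;
  have := ltn_ord (w^-1%g a); have := ltn_ord (w^-1%g b); have := ltn_ord (w^-1%g c);
  have := ltn_ord c; have : w^-1%g a != w^-1%g b by [rewrite (inj_eq perm_inj) -val_eqE /=; lia].
all: have : w^-1%g b != w^-1%g c by [rewrite (inj_eq perm_inj) -val_eqE /=; lia].
all: rewrite -!val_eqE /=; lia.
Qed.

Lemma keys_inj w : [/\ injective (key_upper_value w), injective (key_lower_value w),
  injective (key_upper_position w) & injective (key_lower_position w)].
Proof.
have pE (a b : 'I_n) : w^-1%g a = w^-1%g b :> nat -> a = b.
  by move=> /val_inj /perm_inj.
have sE (a b : 'I_n) : n - a = n - b -> a = b.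
  by move=> e; apply: val_inj => /=; have := ltn_ord a; have := ltn_ord b; lia.
have in1 : injective (key_upper_value w).
  move=> [a b] [c d] /lex_inj[||/= e1 e2]; rewrite ?leq_subr //.
  congr pair; [|exact: val_inj]; exact/perm_inj/sE/e2.
have in2 : injective (key_lower_value w).
  move=> [a b] [c d] /lex_inj[||/= e1 e2]; rewrite ?(ltnW (ltn_ord _)) //.
  by rewrite (sE _ _ e1) (pE _ _ e2).
split=> //.
- move=> [a b] [c d] /lex_inj[||/= e1 e2]; rewrite ?leq_subr //.
  by rewrite (sE _ _ e2) (pE _ _ e1).
- move=> [a b] [c d] /lex_inj[||/= e1 e2]; rewrite ?(ltnW (ltn_ord _)) //.
  congr pair; [|exact: val_inj]; exact/perm_inj/sE/e1.
Qed.

Lemma exists_reduced w : exists u, reduced w u.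
Proof.
have [conv _ _ _] := convex_keys w; have [inj _ _ _] := keys_inj w.
by have [u red _] := exists_sorted_word (in2W inj) conv; exists u.
Qed.

(** The combinatorial form of [L2_of]: unordered pairs of inversions without common
    lower or upper value.  The condition on the upper values only selects one of
    the two orientations.  A decreasing pattern c b a is represented by the pair
    (a, b), (b, c). *)
Definition flip_pairs w : {set ('I_n * 'I_n) * ('I_n * 'I_n)} :=
  [set xy | [&& xy.1 \in inversions w, xy.2 \in inversions w,
                xy.1.2 < xy.2.2 & xy.1.1 != xy.2.1]]%SET.

Lemma four_reduced_words w : exists u1 u2 u3 u4,
  [/\ [/\ reduced w u1, reduced w u2, reduced w u3 & reduced w u4] &
      forall x y, (x, y) \in flip_pairs w ->
        [/\ before u1 x y, before u2 x y = (y.1 < x.1),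
            before u3 x y = (w^-1%g x.2 < w^-1%g y.2) &
            before u4 x y = (w^-1%g y.1 < w^-1%g x.1)]].
Proof.
have [c1 c2 c3 c4] := convex_keys w; have [i1 i2 i3 i4] := keys_inj w.
have [u1 r1 b1] := exists_sorted_word (in2W i1) c1.
have [u2 r2 b2] := exists_sorted_word (in2W i2) c2.
have [u3 r3 b3] := exists_sorted_word (in2W i3) c3.
have [u4 r4 b4] := exists_sorted_word (in2W i4) c4.
exists u1, u2, u3, u4; split=> // x y; rewrite inE /= => /and4P[xw yw lt neq].
rewrite b1 // b2 // b3 // b4 //.
rewrite /key_upper_value /key_lower_value /key_upper_position /key_lower_position.
rewrite !lex_lt ?leq_subr ?(ltnW (ltn_ord _)) //.
have := ltn_ord (w^-1%g x.1); have := ltn_ord (w^-1%g y.1).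
have := ltn_ord x.1; have := ltn_ord y.1.
have : w^-1%g x.1 != w^-1%g y.1 by rewrite (inj_eq perm_inj).
have : w^-1%g x.2 != w^-1%g y.2 by rewrite (inj_eq perm_inj) -val_eqE /=; lia.
move: neq; rewrite -!val_eqE /= => *; split; lia.
Qed.

End Keys.

(** * Coxeter moves and connectedness *)

Section Moves.
Context (n : nat).
Implicit Types (w p : 'S_n) (i j : 'I_n.-1) (u v : seq 'I_n.-1).

Definition far i j := (i.+1 < j) || (j.+1 < i).
Definition adjacent i j := (i.+1 == j) || (j.+1 == i).

Lemma far_adjacent i j : i != j -> far i j || adjacent i j.
Proof. rewrite -val_eqE /= /far /adjacent; lia. Qed.

Lemma refl_fix i (x : 'I_n) : x != left_pos i -> x != right_pos i -> simple_refl i x = x.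
Proof. by move=> xl xh; apply: tpermD; rewrite eq_sym. Qed.

Lemma far_refl i j (x : 'I_n) : far i j ->
  (x == left_pos j) || (x == right_pos j) -> simple_refl i x = x.
Proof.
by rewrite /far => ij xj; apply: refl_fix; move: ij xj; rewrite -!val_eqE /=; lia.
Qed.

(** A generator fixes both positions exchanged by a distant one, so conjugation
    leaves the distant transposition unchanged. *)
Lemma far_comm i j : far i j ->
  (simple_refl i * simple_refl j = simple_refl j * simple_refl i)%g.
Proof.
move=> ij; apply/esym/commgP/conjg_fixP; rewrite tpermJ.
by rewrite !(far_refl ij) ?eqxx ?orbT.
Qed.

(** Both sides are the transposition of the two outer positions, written as a
    conjugate in two ways. *)
Lemma braid_up i j : i.+1 = j ->
  (simple_refl i * simple_refl j * simple_refl i =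
   simple_refl j * simple_refl i * simple_refl j)%g.
Proof.
move=> ij; have hl : right_pos i = left_pos j by apply: val_inj; rewrite /= ij.
have conj (s t : 'I_n.-1) : (simple_refl s * simple_refl t * simple_refl s =
    simple_refl t ^ simple_refl s)%g by rewrite /conjg tpermV mulgA.
rewrite !conj !tpermJ -/(left_pos i) -/(left_pos j) -/(right_pos i) -/(right_pos j).
have -> : simple_refl i (left_pos j) = left_pos i by rewrite -hl refl_right.
have -> : simple_refl j (right_pos i) = right_pos j by rewrite hl refl_left.
have -> : simple_refl i (right_pos j) = right_pos j.
  by rewrite refl_fix // -val_eqE /=; lia.
have -> : simple_refl j (left_pos i) = left_pos i.
  by rewrite refl_fix // -val_eqE /=; lia.
by [].
Qed.

Lemma braid i j : adjacent i j ->
  (simple_refl i * simple_refl j * simple_refl i =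
   simple_refl j * simple_refl i * simple_refl j)%g.
Proof. by case/orP=> /eqP ij; [|apply/esym]; apply: braid_up. Qed.

Lemma simple_refl_inj : injective (@simple_refl n).
Proof.
move=> i j e; apply: val_inj => /=.
have := val_simple_refl j (left_pos i); rewrite -e refl_left /=.
by do ?[case: ifP => /=]; lia.
Qed.

Lemma refl_mul_neq1 i j : i != j -> (simple_refl i * simple_refl j != 1)%g.
Proof.
apply: contra => /eqP/(canRL (mulgK _)); rewrite mul1g tpermV => e.
by apply/eqP/simple_refl_inj.
Qed.

Lemma coxeter_m_far i j : far i j -> coxeter_m i j = 2.
Proof.
move=> ij; apply: nt_prime_order => //.
  by rewrite expgS expg1 {1}(far_comm ij) mulgA -(mulgA (simple_refl j)) tperm2 mulg1 tperm2.
by apply: refl_mul_neq1; move: ij; rewrite /far -val_eqE /=; lia.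
Qed.

Lemma coxeter_m_adjacent i j : adjacent i j -> coxeter_m i j = 3.
Proof.
move=> ij; apply: nt_prime_order => //.
  rewrite !expgS expg0 mulg1 !mulgA (braid ij).
  rewrite -!mulgA [X in (_ * (_ * X))%g]mulgA tperm2 mul1g.
  by rewrite [X in (_ * X)%g]mulgA tperm2 mul1g tperm2.
by apply: refl_mul_neq1; move: ij; rewrite /adjacent -val_eqE /=; lia.
Qed.

Lemma coxeter_moveP u v : coxeter_move u v <-> exists a b i j,
  (far i j /\ u = a ++ [:: i; j] ++ b /\ v = a ++ [:: j; i] ++ b) \/
  (adjacent i j /\ u = a ++ [:: i; j; i] ++ b /\ v = a ++ [:: j; i; j] ++ b).
Proof.
split=> [[a [b [i [j [neq -> ->]]]]]|[a [b [i [j H]]]]]; exists a, b, i, j.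
  have /orP[ij|ij] := far_adjacent neq.
    by left; rewrite coxeter_m_far.
  by right; rewrite coxeter_m_adjacent.
case: H => -[ij [-> ->]]; split.
- by move: ij; rewrite /far -val_eqE /=; lia.
- by rewrite coxeter_m_far.
- by rewrite coxeter_m_far.
- by move: ij; rewrite /adjacent -val_eqE /=; lia.
- by rewrite coxeter_m_adjacent.
- by rewrite coxeter_m_adjacent.
Qed.

Lemma reduced_wordsP w u : reduced_words w u <-> reduced w u.
Proof.
split=> [[e min]|/andP[/eqP e /eqP size_u]].
  have [v red] := exists_reduced w.
  rewrite /reduced e eqxx eqn_leq -{2}e card_inversions_word andbT.
  case/andP: (red) => _ /eqP <-; apply: min; exact: reduced_word_perm red.
by split=> // v ev; rewrite size_u -ev card_inversions_word.
Qed.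

Lemma G_edgeP w u v :
  reflect [/\ reduced w u, reduced w v & coxeter_move u v] (G_edge w u v).
Proof.
apply: (iffP (asboolP _)) => -[ru rv m]; split=> //; exact/reduced_wordsP.
Qed.

Definition linked w u v := exists2 p, path (G_edge w) u p & last u p = v.

Lemma linked_refl w u : linked w u u.
Proof. by exists [::]. Qed.

Lemma linked_trans w u v t : linked w u v -> linked w v t -> linked w u t.
Proof.
move=> [p pathp <-] [q pathq <-]; exists (p ++ q); first by rewrite cat_path pathp.
by rewrite last_cat.
Qed.

Lemma linked_edge w u v : G_edge w u v -> linked w u v.
Proof. by move=> e; exists [:: v] => //=; rewrite e. Qed.

Lemma linked_rcons w i u v : w (right_pos i) < w (left_pos i) ->
  linked (simple_refl i * w)%g u v -> linked w (rcons u i) (rcons v i).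
Proof.
move=> desc [p]; elim: p u => [|t p IH] u /=; first by move=> _ ->; apply: linked_refl.
move=> /andP[/G_edgeP[ru rt /coxeter_moveP m] pathp] lastp.
apply: linked_trans (IH _ pathp lastp); apply: linked_edge; apply/G_edgeP.
split; rewrite ?reduced_rcons ?desc //; apply/coxeter_moveP.
case: m => a [b [s [r H]]]; exists a, (rcons b i), s, r.
by case: H => -[sr [-> ->]]; [left|right]; rewrite !rcons_cat /=.
Qed.

(** The step of Matsumoto's theorem that uses a Coxeter relation: if [w] descends at
    i and at j, the longest element of the subgroup generated by the two
    reflections can be split off from [w], and both of its reduced words can be
    appended to one reduced word of the rest. *)
Lemma two_descents w i j : i != j ->
    w (right_pos i) < w (left_pos i) -> w (right_pos j) < w (left_pos j) ->
  exists u v, [/\ reduced w (rcons u i), reduced w (rcons v j) &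
    linked w (rcons u i) (rcons v j)].
Proof.
move=> /far_adjacent/orP[ij|ij] di dj.
  have [x redx] := exists_reduced (simple_refl j * (simple_refl i * w))%g.
  have ji : far j i by move: ij; rewrite /far orbC.
  have r1 : reduced w (rcons (rcons x j) i).
    by rewrite !reduced_rcons di redx !refl_mulE !(far_refl ij) ?eqxx ?orbT ?dj.
  have r2 : reduced w (rcons (rcons x i) j).
    rewrite !reduced_rcons dj !refl_mulE !(far_refl ji) ?eqxx ?orbT ?di //=.
    by rewrite mulgA (far_comm ij) -mulgA.
  exists (rcons x j), (rcons x i); split=> //; apply: linked_edge; apply/G_edgeP; split=> //.
  by apply/coxeter_moveP; exists x, [::], j, i; left; rewrite -!cats1 -!catA.
have [x redx] := exists_reduced (simple_refl i * (simple_refl j * (simple_refl i * w)))%g.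
have ji : adjacent j i by move: ij; rewrite /adjacent orbC.
have redx' : reduced (simple_refl j * (simple_refl i * (simple_refl j * w)))%g x.
  by move: redx; rewrite !mulgA (braid ij).
(* In the braid case three consecutive entries are decreasing, and each of the
   two alternating words reverses them. *)
have key s t : adjacent s t ->
    w (right_pos s) < w (left_pos s) -> w (right_pos t) < w (left_pos t) ->
    reduced (simple_refl s * (simple_refl t * (simple_refl s * w)))%g x ->
    reduced w (rcons (rcons (rcons x s) t) s).
  move=> st ds dt redx0; rewrite !reduced_rcons redx0 ds !refl_mulE andbT /=.
  case/orP: st => /eqP st.
    have hl : right_pos s = left_pos t by apply: val_inj; rewrite /= st.
    have Es : simple_refl s (right_pos t) = right_pos t.
      by rewrite refl_fix // -val_eqE /=; lia.
    have Et : simple_refl t (left_pos s) = left_pos s.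
      by rewrite refl_fix // -val_eqE /=; lia.
    have Es' : simple_refl s (left_pos t) = left_pos s by rewrite -hl refl_right.
    have Et' : simple_refl t (right_pos s) = right_pos t by rewrite hl refl_left.
    by rewrite Et' Et Es Es' refl_left hl dt (ltn_trans dt) // -hl.
  have hl : right_pos t = left_pos s by apply: val_inj; rewrite /= st.
  have Es : simple_refl s (left_pos t) = left_pos t.
    by rewrite refl_fix // -val_eqE /=; lia.
  have Et : simple_refl t (right_pos s) = right_pos s.
    by rewrite refl_fix // -val_eqE /=; lia.
  have Es' : simple_refl s (right_pos t) = right_pos s by rewrite hl refl_left.
  have Et' : simple_refl t (left_pos s) = left_pos t by rewrite -hl refl_right.
  by rewrite Et' Et Es' Es refl_right -hl dt (ltn_trans _ dt) // hl.
exists (rcons (rcons x i) j), (rcons (rcons x j) i).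
have r1 := key _ _ ij di dj redx; have r2 := key _ _ ji dj di redx'.
split=> //; apply: linked_edge; apply/G_edgeP; split=> //.
by apply/coxeter_moveP; exists x, [::], i, j; right; rewrite -!cats1 -!catA.
Qed.

(** Matsumoto's theorem, by induction on the length.  Words with the same last letter
    are linked by induction; in general the words given by [two_descents] serve
    as intermediate stations. *)
Theorem reduced_linked w u v : reduced w u -> reduced w v -> linked w u v.
Proof.
move: {2}(size u) (erefl (size u)) => N; elim: N w u v => [|N IH] w u v sizeu ru rv.
  have sizev : size v = 0 by rewrite -sizeu; case/andP: rv; case/andP: ru => _ /eqP-> _ /eqP.
  by rewrite (size0nil sizeu) (size0nil sizev); apply: linked_refl.
have sizev : size v = N.+1 by rewrite -sizeu; case/andP: rv; case/andP: ru => _ /eqP-> _ /eqP.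
case/lastP: u sizeu ru => // u i; rewrite size_rcons => -[sizeu] ru.
case/lastP: v sizev rv => // v j; rewrite size_rcons => -[sizev] rv.
have step s x y : size x = N -> reduced w (rcons x s) -> reduced w (rcons y s) ->
    linked w (rcons x s) (rcons y s).
  move=> sizex; rewrite !reduced_rcons => /andP[desc rx] /andP[_ ry].
  exact: linked_rcons desc (IH _ _ _ sizex rx ry).
have [eij|neq] := eqVneq i j; first by rewrite -eij in rv *; apply: step.
have [di dj] : w (right_pos i) < w (left_pos i) /\ w (right_pos j) < w (left_pos j).
  by move: ru rv; rewrite !reduced_rcons => /andP[-> _] /andP[-> _].
have [x [y [rx ry xy]]] := two_descents neq di dj.
apply: linked_trans (step i _ x _ ru rx) (linked_trans xy (step j y _ _ ry rv)) => //.
apply: succn_inj; rewrite -(size_rcons y j).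
by case/andP: ry => _ /eqP->; case/andP: ru => _ /eqP<-; rewrite size_rcons sizeu.
Qed.

End Moves.

(** * Distances between reduced words *)

Lemma index_reorder (T : eqType) (a m m' b : seq T) (x y : T) :
    perm_eq m m' -> ~~ ((x \in m) && (y \in m)) ->
  (index x (a ++ m ++ b) < index y (a ++ m ++ b)) =
  (index x (a ++ m' ++ b) < index y (a ++ m' ++ b)).
Proof.
move=> mm'; rewrite !index_cat -!(perm_mem mm') -(perm_size mm').
have := index_mem x a; have := index_mem y a.
have := index_mem x m; have := index_mem y m.
have := index_mem x m'; have := index_mem y m'.
rewrite -!(perm_mem mm') -(perm_size mm').
by case: (x \in a); case: (y \in a); case: (x \in m); case: (y \in m) => //=; lia.
Qed.

Section Distances.
Context (n : nat).
Implicit Types (w : 'S_n) (i j : 'I_n.-1) (u v : seq 'I_n.-1).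
Implicit Types (x y : 'I_n * 'I_n).

(** The pairs whose members [u] and [v] create in opposite orders, that is, the set
    L_2(u, v) of rank-two subspaces separating two galleries. *)
Definition flipped w u v :=
  [set xy in flip_pairs w | before u xy.1 xy.2 != before v xy.1 xy.2]%SET.

Lemma swaps_far (p : 'S_n) i j : far i j ->
  swaps p [:: i; j] = [:: (p (left_pos i), p (right_pos i)); (p (left_pos j), p (right_pos j))].
Proof. by move=> ij /=; rewrite !refl_mulE !(far_refl ij) ?eqxx ?orbT. Qed.

Lemma swaps_braid (p : 'S_n) i j : i.+1 = j ->
  swaps p [:: i; j; i] =
    [:: (p (left_pos i), p (right_pos i)); (p (left_pos i), p (right_pos j));
        (p (right_pos i), p (right_pos j))] /\
  swaps p [:: j; i; j] =
    [:: (p (right_pos i), p (right_pos j)); (p (left_pos i), p (right_pos j));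
        (p (left_pos i), p (right_pos i))].
Proof.
move=> ij; have hl : right_pos i = left_pos j by apply: val_inj; rewrite /= ij.
have Ei : simple_refl i (right_pos j) = right_pos j by rewrite refl_fix // -val_eqE /=; lia.
have Ej : simple_refl j (left_pos i) = left_pos i by rewrite refl_fix // -val_eqE /=; lia.
have Ei' : simple_refl i (left_pos j) = left_pos i by rewrite -hl refl_right.
have Ej' : simple_refl j (right_pos i) = right_pos j by rewrite hl refl_left.
rewrite /= !(refl_mulE, Ei, Ej, Ei', Ej', refl_left, refl_right).
by split=> //; rewrite hl.
Qed.

(** A move permutes a block of two inversions, or of the three inversions (a, b),
    (a, c), (b, c); either block contains a single flip pair, in the second case
    because (a, c) shares its lower or its upper value with each of the others. *)
Lemma swaps_move u v : coxeter_move u v ->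
  exists a m m' b,
    [/\ inv_seq u = a ++ m ++ b, inv_seq v = a ++ m' ++ b, perm_eq m m' &
      forall w, {subset m <= inversions w} ->
        {in [set xy in flip_pairs w | (xy.1 \in m) && (xy.2 \in m)]%SET &,
           forall s t, s = t}].
Proof.
case/coxeter_moveP => a [b [i [j H]]].
have cut s t : inv_seq (a ++ s ++ t) = inv_seq a ++ swaps (word_perm a) s ++
    swaps (word_perm s * word_perm a)%g t.
  by rewrite /inv_seq !swaps_cat mulg1.
case: H => -[ij [-> ->]].
  have ji : far j i by move: ij; rewrite /far orbC.
  exists (inv_seq a), (swaps (word_perm a) [:: i; j]), (swaps (word_perm a) [:: j; i]).
  exists (swaps (word_perm [:: i; j] * word_perm a)%g b).
  rewrite !cut !swaps_far //; split=> //.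
  - by rewrite /word_perm /= !big_cons big_nil !mulg1 (far_comm ij).
  - by apply/seq.permP => P /=; lia.
  move: (_, _) (_, _) => e f w _ [x y] [x' y']; rewrite !inE /=.
  move=> /andP[/and4P[_ _ lt neq] /andP[/orP[]/eqP ex /orP[]/eqP ey]];
  move=> /andP[/and4P[_ _ lt' neq'] /andP[/orP[]/eqP ex' /orP[]/eqP ey']];
  by subst; rewrite ?ltnn // in lt lt' *; lia.
have main A B C m w : perm_eq m [:: (A, B); (A, C); (B, C)] ->
    {subset m <= inversions w} ->
    {in [set xy in flip_pairs w | (xy.1 \in m) && (xy.2 \in m)]%SET &,
       forall s t, s = t}.
  move=> /perm_mem em sub.
  suff key : {in [set xy in flip_pairs w | (xy.1 \in m) && (xy.2 \in m)]%SET,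
      forall s, s = ((A, B), (B, C))} by move=> s t /key-> /key->.
  have : (B, C) \in inversions w by apply: sub; rewrite em !inE eqxx !orbT.
  rewrite inE /= => /andP[BC _].
  move=> [x y]; rewrite 2!inE /= !em !inE.
  move=> /andP[/and4P[_ _ lt neq] /andP[/or3P[]/eqP ex /or3P[]/eqP ey]];
  by move: lt neq; rewrite ex ey /= ?ltnn ?eqxx //; lia.
have wp : word_perm [:: i; j; i] = word_perm [:: j; i; j].
  by rewrite /word_perm /= !big_cons big_nil !mulg1 !mulgA (braid ij).
have p3 (x y z : 'I_n * 'I_n) : perm_eq [:: x; y; z] [:: z; y; x].
  by apply/seq.permP => P /=; lia.
exists (inv_seq a), (swaps (word_perm a) [:: i; j; i]), (swaps (word_perm a) [:: j; i; j]).
exists (swaps (word_perm [:: i; j; i] * word_perm a)%g b).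
rewrite !cut wp; case/orP: ij => /eqP ij; have [-> ->] := swaps_braid (word_perm a) ij.
  by split=> // w; apply: main.
by split=> // w; apply: main.
Qed.

Lemma card_flipped_edge w u v : G_edge w u v -> #|flipped w u v| <= 1.
Proof.
case/G_edgeP => ru rv /swaps_move[a [m [m' [b [Eu Ev mm' uniq_m]]]]].
have sub : {subset m <= inversions w}.
  by move=> x xm; rewrite -(mem_inv_seq ru) Eu !mem_cat xm orbT.
apply: leq_trans (_ : _ <= #|[set xy in flip_pairs w | (xy.1 \in m) && (xy.2 \in m)]%SET|) _.
  apply: subset_leq_card; apply/subsetP => -[x y]; rewrite !inE /= => /andP[->].
  rewrite /before Eu Ev; apply: contraR => nxy; apply/eqP; exact: index_reorder.
by apply/card_le1_eqP => s t sD tD; apply: (uniq_m w sub t s tD sD).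
Qed.

Lemma card_flipped_path w u p : path (G_edge w) u p -> #|flipped w u (last u p)| <= size p.
Proof.
elim: p u => [|t p IH] u /=.
  by rewrite leqn0 cards_eq0 => _; apply/eqP/setP => x; rewrite !inE eqxx andbF.
move=> /andP[ut /IH le]; rewrite -(add1n (size p)).
apply: leq_trans (leq_add (card_flipped_edge ut) le); apply: leq_trans (leq_card_setU _ _).
apply: subset_leq_card; apply/subsetP => xy; rewrite !in_setU !inE.
by case/andP => ->; case: (before u _ _); case: (before t _ _); case: (before _ _ _).
Qed.

Lemma nat_minP (A : nat -> Prop) k : A k -> A (nat_min A) /\ nat_min A <= k.
Proof.
move=> Ak; rewrite /nat_min; case: classical_sets.xgetP => [m _ [Am min]|none].
  by split=> //; apply: min.
have ex : exists m, `[< A m >] by exists k; apply/asboolP.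
have [m /asboolP Am min] := ex_minnP ex.
by case: (none m); split=> // l Al; apply: min; apply/asboolP.
Qed.

Lemma nat_maxP (A : nat -> Prop) k B : A k -> (forall l, A l -> l <= B) ->
  A (nat_max A) /\ k <= nat_max A.
Proof.
move=> Ak bound; rewrite /nat_max; case: classical_sets.xgetP => [m _ [Am max]|none].
  by split=> //; apply: max.
have ex : exists m, `[< A m >] by exists k; apply/asboolP.
have ub m : `[< A m >] -> m <= B by move/asboolP; apply: bound.
have [m /asboolP Am max] := ex_maxnP ex ub.
by case: (none m); split=> // l Al; apply: max; apply/asboolP.
Qed.

(** By [reduced_linked] the default value of [nat_min] does not occur here. *)
Lemma graph_distP w u v : reduced w u -> reduced w v ->
  exists p, [/\ path (G_edge w) u p, last u p = v & size p = graph_dist (G_edge w) u v].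
Proof.
move=> ru rv; have [p pathp lastp] := reduced_linked ru rv.
by have [] := @nat_minP (fun k => exists p, [/\ path (G_edge w) u p, last u p = v & size p = k])
  (size p) (ex_intro _ p (And3 pathp lastp erefl)).
Qed.

Lemma graph_dist_le w u p : path (G_edge w) u p ->
  graph_dist (G_edge w) u (last u p) <= size p.
Proof.
move=> pathp; by have [] := @nat_minP
  (fun k => exists q, [/\ path (G_edge w) u q, last u q = last u p & size q = k])
  (size p) (ex_intro _ p (And3 pathp erefl erefl)).
Qed.

Lemma flipped_le_dist w u v : reduced w u -> reduced w v ->
  #|flipped w u v| <= graph_dist (G_edge w) u v.
Proof.
by move=> ru rv; have [p [pathp <- <-]] := graph_distP ru rv; apply: card_flipped_path.
Qed.

(** Reduced words of [w] all have the same length, so there are finitely many. *)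
Lemma dist_bounded w : exists B, forall u v, reduced w u -> reduced w v ->
  graph_dist (G_edge w) u v <= B.
Proof.
pose N := #|inversions w|.
exists (\max_(uv : N.-tuple 'I_n.-1 * N.-tuple 'I_n.-1) graph_dist (G_edge w) uv.1 uv.2).
move=> u v /andP[_ su] /andP[_ sv].
exact: (@leq_bigmax _ (fun uv : N.-tuple 'I_n.-1 * N.-tuple 'I_n.-1 =>
  graph_dist (G_edge w) uv.1 uv.2) (Tuple su, Tuple sv)).
Qed.

(** The set of distances is nonempty and bounded, so [nat_max] does not take its
    default value. *)
Lemma diam_GP w : exists u v, [/\ reduced w u, reduced w v & diam_G w = graph_dist (G_edge w) u v].
Proof.
have [B bound] := dist_bounded w; have [u red] := exists_reduced w.
pose A d := exists u v, [/\ reduced_words w u, reduced_words w v & d = graph_dist (G_edge w) u v].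
have [|_ [s [t [/reduced_wordsP rs /reduced_wordsP rt ->]]]|[s [t [rs rt e]]] _] :=
    @nat_maxP A (graph_dist (G_edge w) u u) B.
- by exists u, u; split=> //; apply/reduced_wordsP.
- exact: bound.
- by exists s, t; split=> //; apply/reduced_wordsP.
Qed.

Lemma dist_le_diam w u v : reduced w u -> reduced w v -> graph_dist (G_edge w) u v <= diam_G w.
Proof.
move=> ru rv; have [B bound] := dist_bounded w.
pose A d := exists u v, [/\ reduced_words w u, reduced_words w v & d = graph_dist (G_edge w) u v].
have [|_ [s [t [/reduced_wordsP rs /reduced_wordsP rt ->]]]|//] :=
    @nat_maxP A (graph_dist (G_edge w) u v) B.
- by exists u, v; split=> //; apply/reduced_wordsP.
- exact: bound.
Qed.

Lemma flipped_le_diam w u v : reduced w u -> reduced w v -> #|flipped w u v| <= diam_G w.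
Proof. by move=> ru rv; apply: leq_trans (dist_le_diam ru rv); apply: flipped_le_dist. Qed.

End Distances.

(** * The lower bound and its extremal case *)

Section Counting.
Context (n : nat).
Implicit Types (w : 'S_n) (x y : 'I_n * 'I_n).

(** The flip pairs on which the two words sorted by value differ. *)
Definition lowers_increase w := [set xy in flip_pairs w | xy.1.1 < xy.2.1]%SET.

(** The flip pairs on which the two words sorted by position differ. *)
Definition positions_disagree w :=
  [set xy in flip_pairs w |
    (w^-1%g xy.1.2 < w^-1%g xy.2.2) != (w^-1%g xy.2.1 < w^-1%g xy.1.1)]%SET.

Lemma in_lowers_increase w x y :
  ((x, y) \in lowers_increase w) = ((x, y) \in flip_pairs w) && (x.1 < y.1).
Proof. by rewrite inE. Qed.

Lemma in_positions_disagree w x y :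
  ((x, y) \in positions_disagree w) = ((x, y) \in flip_pairs w) &&
    ((w^-1%g x.2 < w^-1%g y.2) != (w^-1%g y.1 < w^-1%g x.1)).
Proof. by rewrite inE. Qed.

Lemma in_flipped w u v x y :
  ((x, y) \in flipped w u v) = ((x, y) \in flip_pairs w) && (before u x y != before v x y).
Proof. by rewrite inE. Qed.

Definition swap_lowers (xy : ('I_n * 'I_n) * ('I_n * 'I_n)) :=
  ((xy.2.1, xy.1.2), (xy.1.1, xy.2.2)).

Lemma swap_lowersK : involutive swap_lowers.
Proof. by case=> -[a b] [c d]. Qed.

Lemma pos_neq w (a b : 'I_n) : a < b -> w^-1%g a != w^-1%g b :> nat.
Proof. by move=> ab; rewrite val_eqE (inj_eq perm_inj) -val_eqE /=; lia. Qed.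

Lemma card_flip_pairs_le w : #|lowers_increase w| + #|positions_disagree w| <= (diam_G w).*2.
Proof.
have [u1 [u2 [u3 [u4 [[r1 r2 r3 r4] H]]]]] := four_reduced_words w.
rewrite -addnn; apply: leq_add.
  apply: leq_trans (flipped_le_diam r1 r2); apply: subset_leq_card.
  apply/subsetP => -[x y]; rewrite in_lowers_increase in_flipped => /andP[xy lt].
  rewrite xy /=; have [-> -> _ _] := H _ _ xy; lia.
apply: leq_trans (flipped_le_diam r3 r4); apply: subset_leq_card.
apply/subsetP => -[x y]; rewrite in_positions_disagree in_flipped => /andP[xy neq].
by rewrite xy /=; have [_ _ -> ->] := H _ _ xy.
Qed.

(** Let (a, b), (c, d) be a pair with b < d for which neither condition holds.  Then
    c < a < b < d, and the entries read d b a c or b d c a: the patterns 4321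
    and 3412.  The pair (c, b), (a, d) lies in the same pattern and satisfies
    both conditions. *)
Lemma swap_lowers_defect w :
  {in flip_pairs w :\: (lowers_increase w :|: positions_disagree w), forall xy,
    swap_lowers xy \in lowers_increase w :&: positions_disagree w}%SET.
Proof.
move=> [[a b] [c d]]; rewrite !inE /swap_lowers /= => H.
have : w^-1%g b != w^-1%g d :> nat by apply: pos_neq; move: H; lia.
have : w^-1%g c != w^-1%g a :> nat by apply: pos_neq; move: H; rewrite -!val_eqE /=; lia.
move: H; rewrite -!val_eqE /=; lia.
Qed.

(** Inclusion-exclusion for the two conditions. *)
Lemma flip_pairs_count w :
  #|flip_pairs w| + #|lowers_increase w :&: positions_disagree w|%SET =
  #|lowers_increase w| + #|positions_disagree w| +
  #|flip_pairs w :\: (lowers_increase w :|: positions_disagree w)|%SET.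
Proof.
rewrite -(cardsUI (lowers_increase w)) addnAC; congr addn.
rewrite -(cardsID (lowers_increase w :|: positions_disagree w)%SET (flip_pairs w)).
congr addn; apply: eq_card => -[x y]; rewrite in_setI !in_setU.
by rewrite in_lowers_increase in_positions_disagree; case: (_ \in flip_pairs w).
Qed.

Lemma card_defect_le w :
  #|flip_pairs w :\: (lowers_increase w :|: positions_disagree w)|%SET <=
  #|lowers_increase w :&: positions_disagree w|%SET.
Proof.
rewrite -(card_imset _ (inv_inj swap_lowersK)); apply: subset_leq_card.
by apply/subsetP => _ /imsetP[xy xyD ->]; apply: swap_lowers_defect.
Qed.

Lemma half_flip_pairs_le_diam w : #|flip_pairs w| <= (diam_G w).*2.
Proof.
by have := flip_pairs_count w; have := card_defect_le w; have := card_flip_pairs_le w; lia.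
Qed.

(** If the bound is attained, the pairs satisfying neither condition and those
    satisfying both are equally numerous, so the injection between them is
    onto. *)
Lemma extremal_swap w : (diam_G w).*2 <= #|flip_pairs w| ->
  {in lowers_increase w :&: positions_disagree w, forall xy, swap_lowers xy \in flip_pairs w}%SET.
Proof.
move=> le xy xyS.
have : (swap_lowers @: (flip_pairs w :\: (lowers_increase w :|: positions_disagree w)) ==
    lowers_increase w :&: positions_disagree w)%SET.
  rewrite eqEcard card_imset; last exact: inv_inj swap_lowersK.
  apply/andP; split.
    by apply/subsetP => _ /imsetP[z zD ->]; apply: swap_lowers_defect.
  rewrite -(leq_add2l #|flip_pairs w|) flip_pairs_count leq_add2r.
  exact: leq_trans (card_flip_pairs_le w) le.
move/eqP=> E; move: xyS; rewrite -E => /imsetP[z + ->].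
by rewrite swap_lowersK in_setD => /andP[_].
Qed.

(** Lower and upper values of inversions form a complete bipartite graph; in
    particular no value is both lower and upper. *)
Definition biclique w :=
  {in inversions w &, forall x y, (x.1, y.2) \in inversions w}.

(** A pattern 321 gives the pair (a, b), (b, c), on which both conditions hold
    but whose image (b, b), (a, c) is no pair of inversions.  Without 321 upper
    values keep their order, as do lower values; then two inversions with
    distinct lower and distinct upper values are either nested, and the crossed
    pairs are inversions for reasons of position, or both conditions hold and
    [extremal_swap] applies. *)
Lemma extremal_biclique w : (diam_G w).*2 <= #|flip_pairs w| -> biclique w.
Proof.
move=> /extremal_swap ext.
have {ext} ext (a b c d : 'I_n) : (a, b) \in inversions w -> (c, d) \in inversions w ->
    a < c -> b < d -> (w^-1%g b < w^-1%g d) != (w^-1%g c < w^-1%g a) ->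
    (c, b) \in inversions w /\ (a, d) \in inversions w.
  move=> abw cdw ac bd neq; have := ext ((a, b), (c, d)).
  rewrite !in_setI !inE /= => H; apply/andP; move: H abw cdw.
  rewrite !inE -!val_eqE /=; lia.
have no321 (a b c : 'I_n) : (a, b) \in inversions w -> (b, c) \in inversions w -> False.
  move=> abw bcw; have := ext _ _ _ _ abw bcw.
  by move: abw bcw; rewrite !inE /=; lia.
have noinv (a b : 'I_n) : (a, b) \notin inversions w -> a < b -> w^-1%g a < w^-1%g b.
  by move=> + ab; have := pos_neq w ab; rewrite inE /= ab /=; lia.
have key (a b c d : 'I_n) : (a, b) \in inversions w -> (c, d) \in inversions w ->
    b < d -> (c, b) \in inversions w /\ (a, d) \in inversions w.
  move=> abw cdw bd.
  have bd' : w^-1%g b < w^-1%g d.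
    by apply: noinv => //; apply/negP => bdw; apply: no321 abw bdw.
  have [ac|ca|/val_inj eac] := ltngtP a c; last first.
  - by split; [rewrite -eac|rewrite eac].
  - have ca' : w^-1%g c < w^-1%g a.
      by apply: noinv => //; apply/negP => caw; apply: no321 caw abw.
    by move: abw cdw; rewrite !inE /=; lia.
  have ac' : w^-1%g a < w^-1%g c.
    by apply: noinv => //; apply/negP => acw; apply: no321 acw cdw.
  by apply: ext => //; move: bd' ac'; lia.
move=> [a b] [c d] abw cdw /=.
have [bd|db|/val_inj <-//] := ltngtP b d; first by have [] := key _ _ _ _ abw cdw bd.
by have [] := key _ _ _ _ cdw abw db.
Qed.

Definition rectangle (i k j : nat) : {set 'I_n * 'I_n} :=
  [set x : 'I_n * 'I_n | (i <= x.1 < i + k) && (i + k <= x.2 < i + k + j)]%SET.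

(** Let a be the least lower, b the least upper and c the greatest upper value.  A value
    strictly between a and b forms an inversion with one of them by
    [inversion_split], and it is a lower value since b is the least upper one;
    similarly the values between b and c are upper values. *)
Lemma biclique_rectangle w : biclique w ->
  exists i k j, i + k + j <= n /\ inversions w = rectangle i k j.
Proof.
move=> bi; have [w0|[x0 x0w]] := set_0Vmem (inversions w).
  (* The identity permutation corresponds to the empty rectangle. *)
  by exists 0, 0, 0; split=> //; rewrite w0; apply/setP => x; rewrite !inE; lia.
have [[a b'] abw mina] := @arg_minnP _ x0 (mem (inversions w)) (fun x => x.1) x0w.
have [[a' b] bw minb] := @arg_minnP _ x0 (mem (inversions w)) (fun x => x.2) x0w.
have [[a'' c] cw maxc] := @arg_maxnP _ x0 (mem (inversions w)) (fun x => x.2) x0w.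
have abw' : (a, b) \in inversions w := bi _ _ abw bw.
have acw : (a, c) \in inversions w := bi _ _ abw cw.
have lt_ab : a < b by move: abw'; rewrite inE => /andP[].
have le_bc : b <= c := minb _ cw.
exists a, (b - a), (c.+1 - b); split; first by have := ltn_ord c; lia.
apply/setP => -[p q]; apply/idP/idP => [pqw|].
  have := mina _ pqw; have := minb _ pqw; have := maxc _ pqw.
  have : (p, b) \in inversions w := bi _ _ pqw bw.
  rewrite inE /= => /andP[pb _]; rewrite inE /=; lia.
rewrite inE /= => H.
have pbw : (p, b) \in inversions w.
  have [/val_inj->//|neq] := eqVneq (p : nat) a.
  have apb : a < p < b by lia.
  case/orP: (inversion_split apb abw') => // apw.
  by have := minb _ apw; rewrite /= leqNgt; lia.
have aqw : (a, q) \in inversions w.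
  have [/val_inj->//|neq] := eqVneq (q : nat) c.
  have aqc : a < q < c by lia.
  case/orP: (inversion_split aqc acw) => // qcw.
  by have := bi _ _ qcw bw; rewrite inE /=; lia.
exact: (bi _ _ pbw aqw).
Qed.

Lemma rectangle_biclique w i k j : inversions w = rectangle i k j -> biclique w.
Proof. by move=> E x y; rewrite E !inE /=; lia. Qed.

End Counting.

(** The middle entries are the j large values followed by the k small ones, each
    group increasing, so the inversions pair a small value with a large one. *)
Lemma inversions_block (i j k l : nat) :
  inversions (direct_sum (direct_sum (id_perm i) (skew_sum (id_perm j) (id_perm k)))
                (id_perm l)) = rectangle _ i k j.
Proof.
set v := direct_sum _ _.
(* Listed by position: the fixed initial part, the entries raised by k, the
   entries lowered by j, the fixed final part. *)
have vE (P : 'I_(i + (j + k) + l)) :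
    [\/ P < i /\ v P = P :> nat, (i <= P < i + j) /\ v P = P + k :> nat,
        (i + j <= P < i + j + k) /\ P = v P + j :> nat | i + j + k <= P /\ v P = P :> nat].
  rewrite /v /direct_sum permE; case: (split_ordP P) => [Q ->|Q ->] /=; last first.
    by rewrite perm1 /=; constructor 4; lia.
  rewrite permE; case: (split_ordP Q) => [Q' ->|Q' ->] /=.
    by rewrite perm1; constructor 1; split=> //; apply: ltn_ord.
  rewrite /skew_sum permE; case: (split_ordP Q') => [Q'' ->|Q'' ->] /=; rewrite perm1 /=.
    by constructor 2; have := ltn_ord Q''; lia.
  by constructor 3; have := ltn_ord Q''; lia.
apply/setP => -[a b]; rewrite !inE /=.
have := vE (v^-1%g a); have := vE (v^-1%g b); rewrite !permKV.
move: (v^-1%g a) (v^-1%g b) => P Q.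
by move=> [[? ?]|[? ?]|[? ?]|[? ?]] [[? ?]|[? ?]|[? ?]|[? ?]]; lia.
Qed.

Lemma biclique_block n (w : 'S_n) : biclique w <->
  exists (i j k l : nat) (e : (i + (j + k) + l)%N = n),
    w = cast_perm e
          (direct_sum
             (direct_sum (id_perm i) (skew_sum (id_perm j) (id_perm k)))
             (id_perm l)).
Proof.
split=> [/biclique_rectangle[i [k [j [le E]]]]|[i [j [k [l [e ->]]]]]].
  have e : i + (j + k) + (n - (i + k + j)) = n by lia.
  exists i, j, k, (n - (i + k + j)), e; apply: inversions_inj; rewrite E.
  move: (n - _) e => l e; case: n / e w le E => w le E.
  by rewrite inversions_block.
case: n / e w => _; apply: (@rectangle_biclique _ _ i k j).
exact: inversions_block.
Qed.

(** * Geodesics when the inversions form a rectangle *)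

Lemma sorted_before n w (u : seq 'I_n.-1) : reduced w u -> sorted (before u) (inv_seq u).
Proof.
move=> ru; case E : (inv_seq u) => [//|x0 s]; rewrite -E.
apply/(sortedP x0) => t lt; rewrite /before !index_uniq ?(inv_seq_uniq ru) //.
exact: ltnW.
Qed.

Lemma swaps_inj n (p : 'S_n) : injective (swaps p).
Proof.
move=> u; elim: u p => [|i u IH] p [|j v] //= [/perm_inj eij _ E].
have ij : i = j by apply: val_inj; move/(congr1 val): eij.
by rewrite -ij in E *; rewrite (IH _ _ E).
Qed.

Lemma in_flip_pairs n (w : 'S_n) x y : ((x, y) \in flip_pairs w) =
  [&& x \in inversions w, y \in inversions w, x.2 < y.2 & x.1 != y.1].
Proof. by rewrite inE. Qed.

Lemma sorted_or_break (T : eqType) (e : rel T) (s : seq T) :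
  sorted e s \/ exists al x y be, s = al ++ x :: y :: be /\ ~~ e x y.
Proof.
case: s => [|x s]; first by left.
elim: s x => [|y s IH] x; first by left.
have [/= exy|nexy] := boolP (e x y); last by right; exists [::], x, y, s.
case: (IH y) => [srt|[al [x' [y' [be [-> nexy]]]]]]; first by left; rewrite exy.
by right; exists (x :: al), x', y', be.
Qed.

Lemma swaps_break n (p : 'S_n) u al x y be : swaps p u = al ++ x :: y :: be ->
  exists a i j b, let q := (word_perm a * p)%g in
    [/\ u = a ++ i :: j :: b, swaps p a = al, x = (q (left_pos i), q (right_pos i)) &
        y = (q (simple_refl i (left_pos j)), q (simple_refl i (right_pos j)))].
Proof.
elim: al p u => [|m al IH] p [|i u] //=.
  case: u => [//|j b] /= [<- <- _]; exists [::], i, j, b.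
  by rewrite word_perm_nil mul1g !refl_mulE.
move=> [<- /IH[a [i' [j [b [-> <- -> ->]]]]]]; exists (i :: a), i', j, b.
by rewrite word_perm_cons -mulgA.
Qed.

Section Biclique.
Context (n : nat) (w : 'S_n) (bi : biclique w).
Implicit Types (u v : seq 'I_n.-1) (x y : 'I_n * 'I_n).

Lemma biclique_no_chain (a b c : 'I_n) :
  (a, b) \in inversions w -> (b, c) \in inversions w -> False.
Proof. by move=> abw bcw; have := bi bcw abw; rewrite inE /= ltnn. Qed.

Lemma before_same_lower u (a b c : 'I_n) : reduced w u ->
    (a, b) \in inversions w -> (a, c) \in inversions w -> b < c ->
  before u (a, b) (a, c).
Proof.
move=> ru abw acw bc; have abc : a < b < c by move: abw; rewrite inE /= => /andP[->].
case/orP: (before_between ru abc acw) => /andP[] // bcw _.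
by case: (biclique_no_chain abw bcw).
Qed.

Lemma before_same_upper u (a b c : 'I_n) : reduced w u ->
    (a, c) \in inversions w -> (b, c) \in inversions w -> a < b ->
  before u (b, c) (a, c).
Proof.
move=> ru acw bcw ab; have abc : a < b < c by move: bcw; rewrite inE /= ab => /andP[->].
case/orP: (before_between ru abc acw) => /andP[] // abw _.
by case: (biclique_no_chain abw bcw).
Qed.

Lemma before_asym u x y : before u x y -> before u y x = false.
Proof. rewrite /before; lia. Qed.

(** If (a, b) and (a, c) are inversions with b < c then (b, c) is not one, because b
    would be both a lower and an upper value; so [before_between] forces
    (a, b) to come first.  The case of a common upper value is symmetric. *)
Lemma before_forced u v x y : reduced w u -> reduced w v ->
    x \in inversions w -> y \in inversions w -> (x.1 == y.1) || (x.2 == y.2) ->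
  before u x y = before v x y.
Proof.
move: x y => [a b] [c d] ru rv xw yw /= /orP[]/eqP e; rewrite e in xw yw *.
  have [bd|db|/val_inj->] := ltngtP b d; last by rewrite /before !ltnn.
    by rewrite !before_same_lower.
  by rewrite !(before_asym (before_same_lower _ _ _ db)).
have [ac|ca|/val_inj->] := ltngtP a c; last by rewrite /before !ltnn.
  by rewrite !(before_asym (before_same_upper _ _ _ ac)).
by rewrite !before_same_upper.
Qed.

(** The inversion (x.1, y.2) lies between x and y: it shares the lower value of x
    and the upper value of y. *)
Lemma before_nested u x y : reduced w u -> x \in inversions w -> y \in inversions w ->
  y.1 < x.1 -> x.2 < y.2 -> before u x y.
Proof.
move: x y => [a b] [c d] /= ru xw yw ca bd.
have adw : (a, d) \in inversions w := bi xw yw.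
exact: ltn_trans (before_same_lower ru xw adw bd) (before_same_upper ru yw adw ca).
Qed.

Lemma flipped_sub_increase u v : reduced w u -> reduced w v ->
  flipped w u v \subset lowers_increase w.
Proof.
move=> ru rv; apply/subsetP => -[x y]; rewrite in_flipped in_lowers_increase.
case/andP=> xyP; rewrite xyP; apply: contraR; rewrite -leqNgt => le.
move: xyP; rewrite inE /= -val_eqE /= => /and4P[xw yw lt neq].
by rewrite !before_nested //; lia.
Qed.

(** Exchanging lower values turns a pair with increasing lower values into a nested
    one, and the biclique condition makes the latter a flip pair. *)
Lemma increase_le_half : (#|lowers_increase w|).*2 <= #|flip_pairs w|.
Proof.
rewrite -(cardsID (lowers_increase w) (flip_pairs w)) -addnn; apply: leq_add.
  apply: subset_leq_card; apply/subsetP => -[x y].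
  by rewrite in_setI in_lowers_increase => /andP[->].
rewrite -(card_imset _ (inv_inj (@swap_lowersK n))); apply: subset_leq_card.
apply/subsetP => _ /imsetP[[x y] + ->]; rewrite in_lowers_increase => /andP[xyP lt].
rewrite in_setD in_lowers_increase /= ltnNge (ltnW lt) andbF /=.
move: xyP; rewrite !in_flip_pairs => /and4P[xw yw lt2 neq] /=.
by rewrite (bi yw xw) (bi xw yw) lt2 eq_sym.
Qed.

(** The bubble-sort step.  If [u] and [v] differ, two consecutive inversions of [u] are
    created in the opposite order by [v].  By [before_forced] they share
    neither lower nor upper value, so the two letters commute, and exchanging them
    corrects the order of this flip pair and of no other. *)
Lemma commuting_descent u v : reduced w u -> reduced w v -> u <> v ->
  exists u', G_edge w u u' /\ flipped w u' v \proper flipped w u v.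
Proof.
move=> ru rv neq.
have [srt|[al [x [y [be [Eu unsorted]]]]]] := sorted_or_break (before v) (inv_seq u).
  case: neq; apply: (@swaps_inj _ 1%g); apply: (@irr_sorted_eq _ (before v)) => //.
  - by move=> y x z; apply: ltn_trans.
  - by move=> x; apply: ltnn.
  - exact: sorted_before rv.
  - by move=> x; rewrite (mem_inv_seq ru) (mem_inv_seq rv).
have := inv_seq_uniq ru; rewrite Eu cat_uniq /= => /and3P[_ + /andP[+ _]].
rewrite !negb_or => /and3P[xal yal _] /andP[xy _].
have [xw yw] : x \in inversions w /\ y \in inversions w.
  by rewrite -!(mem_inv_seq ru) Eu !mem_cat !inE !eqxx !orbT.
have order al' be' s (z z' : 'I_n * 'I_n) : inv_seq s = al' ++ z :: z' :: be' ->
    z \notin al' -> z' \notin al' -> z != z' -> before s z z'.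
  move=> Es zN zN' zz'; rewrite /before Es !index_cat (negbTE zN) (negbTE zN') /=.
  by rewrite !eqxx (negbTE zz') addn0 addn1.
have bu : before u x y by apply: order Eu _ _ _.
have bv : before v y x.
  move: unsorted; rewrite /before -leqNgt leq_eqVlt => /orP[/eqP e|//].
  have yv : y \in inv_seq v by rewrite (mem_inv_seq rv).
  by move: xy; rewrite -(nth_index y yv) e nth_index ?eqxx // (mem_inv_seq rv).
have unforced : ~~ ((x.1 == y.1) || (x.2 == y.2)).
  apply/negP => e; have := before_forced ru rv xw yw e.
  by rewrite bu (before_asym bv).
have [a [i [j [b [eu Ea ex ey]]]]] := swaps_break Eu; rewrite !mulg1 in ex ey.
(* Equal letters would undo an inversion; adjacent letters create inversions
   with a common lower or upper value. *)
have ij : far i j.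
  have [eij|/far_adjacent/orP[//|/orP[]/eqP ij]] := eqVneq i j.
  - by move: xw yw; rewrite ex ey -eij refl_left refl_right !inE /=; lia.
  - have hl : right_pos i = left_pos j by apply: val_inj; rewrite /= ij.
    by case/negP: unforced; rewrite ex ey /= -hl refl_right eqxx.
  - have hl : right_pos j = left_pos i by apply: val_inj; rewrite /= ij.
    by case/negP: unforced; rewrite ex ey /= hl refl_left eqxx orbT.
rewrite !(far_refl ij) ?eqxx ?orbT // in ey.
have ji : far j i by move: ij; rewrite /far orbC.
pose u' := a ++ [:: j; i] ++ b.
have wp : word_perm [:: i; j] = word_perm [:: j; i].
  by rewrite /word_perm /= !big_cons big_nil !mulg1 (far_comm ij).
have ru' : reduced w u'.
  move: ru; rewrite /reduced eu -[i :: _]/([:: i; j] ++ b).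
  by rewrite !word_perm_cat !size_cat wp.
pose be' := swaps (word_perm [:: i; j] * word_perm a)%g b.
have Eu0 : inv_seq u = inv_seq a ++ [:: x; y] ++ be'.
  rewrite eu -[i :: _]/([:: i; j] ++ b) /inv_seq !swaps_cat !mulg1.
  by rewrite (swaps_far _ ij) ex ey.
have Eu' : inv_seq u' = inv_seq a ++ [:: y; x] ++ be'.
  by rewrite /u' /inv_seq !swaps_cat !mulg1 (swaps_far _ ji) -wp ex ey.
have bu' : before u' y x.
  by apply: order Eu' _ _ _; rewrite /inv_seq ?Ea // eq_sym.
exists u'; split.
  apply/G_edgeP; split=> //; apply/coxeter_moveP; exists a, b, i, j; left.
  by rewrite eu.
apply/properP; split.
  apply/subsetP => -[s t]; rewrite !in_flipped => /andP[stP neqst].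
  rewrite stP; apply: contraNN neqst => /eqP eqst.
  have [/andP[]|N] := boolP ((s \in [:: x; y]) && (t \in [:: x; y])).
    move: stP; rewrite in_flip_pairs => /and4P[_ _ lt _].
    rewrite !inE => /orP[]/eqP es /orP[]/eqP et; rewrite es et in eqst lt *.
    + by rewrite ltnn in lt.
    + by rewrite (before_asym bv) (before_asym bu').
    + by rewrite bv bu'.
    + by rewrite ltnn in lt.
  rewrite -eqst /before Eu0 Eu'; apply/eqP/esym.
  by apply: (index_reorder _ _ _ N); rewrite (perm_catC [:: x] [:: y]).
move: unforced; rewrite negb_or => /andP[n1 n2].
have [lt|le] := ltnP x.2 y.2.
  exists (x, y); rewrite in_flipped in_flip_pairs xw yw lt n1 /=.
    by rewrite bu (before_asym bv).
  by rewrite (before_asym bu') (before_asym bv).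
have lt : y.2 < x.2 by rewrite ltn_neqAle le andbT eq_sym val_eqE.
exists (y, x); rewrite in_flipped in_flip_pairs xw yw lt eq_sym n1 /=.
  by rewrite bv (before_asym bu).
by rewrite bu' bv.
Qed.

Lemma dist_le_flipped u v : reduced w u -> reduced w v ->
  graph_dist (G_edge w) u v <= #|flipped w u v|.
Proof.
move=> ru rv.
suff [p [pathp <- le]] : exists p, [/\ path (G_edge w) u p, last u p = v &
    size p <= #|flipped w u v|] by apply: leq_trans (graph_dist_le pathp) le.
move: {2}#|_| (leqnn #|flipped w u v|) => N; elim: N u ru => [|N IH] u ru le.
  have [->|/eqP neq] := eqVneq u v; first by exists [::].
  have [u' [_ /proper_card]] := commuting_descent ru rv neq; lia.
have [->|/eqP neq] := eqVneq u v; first by exists [::].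
have [u' [uu' /proper_card lt]] := commuting_descent ru rv neq.
have ru' : reduced w u' by case/G_edgeP: uu'.
have [|p [pathp lastp sizep]] := IH u' ru'; first by lia.
exists (u' :: p); split=> //=; first by rewrite uu'.
exact: leq_ltn_trans sizep lt.
Qed.

Lemma diam_le_half_flip_pairs : (diam_G w).*2 <= #|flip_pairs w|.
Proof.
have [u [v [ru rv ->]]] := diam_GP w.
apply: leq_trans increase_le_half; rewrite leq_double.
exact: leq_trans (dist_le_flipped ru rv) (subset_leq_card (flipped_sub_increase ru rv)).
Qed.

End Biclique.

(** * The subspaces of codimension two *)

Section Geometry.
Context (R : realType) (n : nat).
Implicit Types (w : 'S_n) (p x y : 'I_n * 'I_n) (v : 'rV[R]_n).

Local Notation root_hyperplane p := (hyperplane (type_A_root R p)).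

Lemma dot_root v p : dot v (type_A_root R p) = (v 0 p.2 - v 0 p.1)%R.
Proof.
have col_entry k : (v *m (delta_mx 0 k : 'rV[R]_n)^T)%R 0%R 0%R = v 0%R k.
  by rewrite trmx_delta -colE mxE.
by rewrite /dot /type_A_root linearB /= mulmxBr [LHS]mxE [X in (_ + X)%R]mxE !col_entry.
Qed.

Lemma mem_root_hyperplane v p : (v \in root_hyperplane p) = (v 0 p.2 == v 0 p.1)%R.
Proof. by rewrite mem_hyperplane dot_root subr_eq0. Qed.

(** On the fundamental chamber coordinates increase, and [w] moves coordinate
    w^-1(k) to coordinate k. *)
Lemma separates_inversion w p : p \in positive_root n ->
  separates (type_A_root R p) (fundamental_chamber R n) (chamber R w) <->
  p \in inversions w.
Proof.
move=> pos; have p12 : p.1 < p.2 by move: pos; rewrite inE.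
have act (z : 'rV[R]_n) i : perm_act w z 0%R i = z 0%R (w^-1%g i) by rewrite mxE.
split=> [sep|].
  rewrite inE p12 /=.
  (* The vector (0, 1, ..., n - 1) witnesses that the chamber is nonempty. *)
  pose z : 'rV[R]_n := (\row_i (i : nat)%:R)%R.
  have zC : fundamental_chamber R n z.
    by move=> q; rewrite inE dot_root !mxE subr_gt0 ltr_nat.
  have := sep z _ zC (ex_intro2 _ _ z zC erefl).
  rewrite !dot_root !act !mxE pmulr_rlt0 ?subr_gt0 ?ltr_nat //.
  by rewrite subr_lt0 ltr_nat.
rewrite inE => /andP[_ inv] x y xC [z zC <-].
have := zC (w^-1%g p.2, w^-1%g p.1); rewrite inE => /(_ inv).
have := xC p pos; rewrite !dot_root !act /= => h1 h2.
by rewrite pmulr_rlt0 // subr_lt0 -subr_gt0.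
Qed.

Lemma dim_cap_hyperplane (U : {vspace 'rV[R]_n}) a v :
  v \in U -> v \notin hyperplane a -> (\dim (U :&: hyperplane a) + 1 = \dim U)%N.
Proof.
move=> vU vH; rewrite -(limg_ker_dim (linfun (mulmxr a^T : 'rV[R]_n -> 'rV[R]_1)) U).
congr addn; apply/eqP; rewrite eq_sym eqn_leq; apply/andP; split.
  by apply: leq_trans (dimvS (subvf _)) _; rewrite dimvf dim_matrix.
rewrite lt0n dimv_eq0; apply: contraNneq vH => im0.
by rewrite memv_ker -memv0 -im0 memv_img.
Qed.

(** Test vectors: these 0-1 vectors detect which values are identified by an
    intersection of root hyperplanes. *)
Definition indicator (T : pred 'I_n) : 'rV[R]_n := (\row_i (T i)%:R)%R.

Lemma mem_indicator T p : (indicator T \in root_hyperplane p) = (T p.2 == T p.1).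
Proof. by rewrite mem_root_hyperplane !mxE eqr_nat; case: (T _); case: (T _). Qed.

Lemma dim_root_hyperplane p : p \in positive_root n -> (\dim (root_hyperplane p) + 1 = n)%N.
Proof.
rewrite inE => p12.
rewrite -[root_hyperplane p]capfv (@dim_cap_hyperplane _ _ (indicator (pred1 p.1))).
- by rewrite dimvf dim_matrix; exact: mul1n.
- exact: memvf.
- by rewrite mem_indicator /= eqxx -val_eqE /=; lia.
Qed.

Lemma dim_cap_roots x y : x \in positive_root n -> y \in positive_root n -> x != y ->
  (\dim (root_hyperplane x :&: root_hyperplane y) + 2 = n)%N.
Proof.
move=> xpos ypos xy.
suff [T eqx neqy] : exists2 T : pred 'I_n, T x.2 == T x.1 & T y.2 != T y.1.
  have := dim_root_hyperplane xpos.
  rewrite -(@dim_cap_hyperplane _ (type_A_root R y) (indicator T)) ?mem_indicator //.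
  by rewrite -addnA.
move: xpos ypos xy; rewrite !inE; case: x y => [a b] [c d] /= ab cd.
rewrite xpair_eqE -!val_eqE /= => neq.
have [cab|cab] := boolP ((c == a :> nat) || (c == b :> nat)).
  by exists (pred1 d); rewrite /= -!val_eqE /=; lia.
by exists (pred1 c); rewrite /= -!val_eqE /=; lia.
Qed.

(** On the intersection the coordinates of x agree, and so do those of y.  An
    equation that holds there equates two coordinates in the same class of the
    equivalence relation generated by these two identifications. *)
Lemma cap_sub_root w x y p : (x, y) \in flip_pairs w -> p \in positive_root n ->
  (root_hyperplane x :&: root_hyperplane y <= root_hyperplane p)%VS ->
  [\/ p = x, p = y | x.2 = y.1 /\ p = (x.1, y.2)].
Proof.
rewrite in_flip_pairs => /and4P[]; rewrite !inE.
case: x y p => [a b] [c d] [e f] /= /andP[ab _] /andP[cd _] bd ac ef sub.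
have key (T : pred 'I_n) : T b == T a -> T d == T c -> T f == T e.
  move=> Tx Ty; rewrite -(mem_indicator T (e, f)); apply: (subvP sub).
  by rewrite memv_cap !mem_indicator Tx Ty.
have e_in : [|| e == a, e == b, e == c | e == d].
  have := key (pred1 e); rewrite /= -!val_eqE /=; clear -ef; lia.
have f_in : [|| f == a, f == b, f == c | f == d].
  have := key (pred1 f); rewrite /= -!val_eqE /=; clear -ef; lia.
have : [|| (e == a) && (f == b), (e == c) && (f == d) | [&& b == c, e == a & f == d]].
  have [ebc|nbc] := eqVneq b c.
    move: e_in f_in; rewrite -ebc -!val_eqE /=; clear -ab bd ef; lia.
  have : (f == a) || (f == b) = (e == a) || (e == b).
    by apply/eqP/(key (pred2 a b)); move: ac nbc; rewrite /= -!val_eqE /=; clear -ab cd bd; lia.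
  by move: e_in f_in ac nbc; rewrite -!val_eqE /=; clear -ab cd bd ef; lia.
case/or3P => [/andP[/eqP-> /eqP->]|/andP[/eqP-> /eqP->]|/and3P[/eqP-> /eqP-> /eqP->]].
- by constructor 1.
- by constructor 2.
- by constructor 3.
Qed.

Definition flip_space (xy : ('I_n * 'I_n) * ('I_n * 'I_n)) : {vspace 'rV[R]_n} :=
  (root_hyperplane xy.1 :&: root_hyperplane xy.2)%VS.

Lemma inversion_positive w : {subset inversions w <= positive_root n}.
Proof. by move=> x; rewrite !inE => /andP[]. Qed.

Lemma flip_pair_neq w x y : (x, y) \in flip_pairs w -> x != y.
Proof.
rewrite in_flip_pairs => /and4P[_ _ lt _]; apply: contraTneq lt => ->.
by rewrite ltnn.
Qed.

Lemma flip_space_L2_of w xy : xy \in flip_pairs w -> L2_of R w (flip_space xy).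
Proof.
case: xy => x y xyP; have := xyP; rewrite in_flip_pairs => /and4P[xw yw _ _].
have xpos := inversion_positive xw; have ypos := inversion_positive yw.
have neq := flip_pair_neq xyP.
split; first split.
- exists [set x; y]%SET; first by rewrite subUset !sub1set xpos ypos.
  by rewrite big_setU1 ?inE //= big_set1.
- exact: dim_cap_roots.
move=> p ppos /(cap_sub_root xyP ppos) H; apply/separates_inversion => //.
case: H => [->//|->//|[e ->]].
by apply: (@inversion_trans n w x.1 x.2 y.2); [|rewrite e]; rewrite -surjective_pairing.
Qed.

(** The hyperplanes through the subspace determine the pair: by [cap_sub_root] there
    are only two or three of them, and in the latter case the third root shares
    its lower or its upper value with each of the others. *)
Lemma flip_space_inj w : {in flip_pairs w &, injective flip_space}.
Proof.
move=> [x y] [x' y'] xyP xyP' E.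
have := xyP'; rewrite in_flip_pairs => /and4P[xw yw lt neq].
have := xyP; rewrite in_flip_pairs => /and4P[_ _ lt0 neq0].
have Hx : [\/ x' = x, x' = y | x.2 = y.1 /\ x' = (x.1, y.2)].
  apply: cap_sub_root xyP (inversion_positive xw) _.
  by rewrite -[(_ :&: _)%VS]/(flip_space (x, y)) E capvSl.
have Hy : [\/ y' = x, y' = y | x.2 = y.1 /\ y' = (x.1, y.2)].
  apply: cap_sub_root xyP (inversion_positive yw) _.
  by rewrite -[(_ :&: _)%VS]/(flip_space (x, y)) E capvSr.
move: lt neq; case: Hx => [->|->|[e ->]]; case: Hy => [->|->|[e' ->]] //=;
  by rewrite ?ltnn ?eqxx // ltnNge (ltnW lt0).
Qed.

Lemma codim2_eq_cap (X : {vspace 'rV[R]_n}) x y : (\dim X + 2 = n)%N ->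
    x \in positive_root n -> y \in positive_root n -> x != y ->
    (X <= root_hyperplane x)%VS -> (X <= root_hyperplane y)%VS ->
  X = flip_space (x, y).
Proof.
move=> dimX xpos ypos neq Xx Xy; apply/eqP; rewrite eqEdim subv_cap Xx Xy /=.
by rewrite -(leq_add2r 2) dimX dim_cap_roots.
Qed.

(** Two distinct roots p, q of the subspace cut it out.  If they share their lower or
    upper value, their difference is up to sign a root vanishing on the subspace,
    hence an inversion, and it replaces one of them. *)
Lemma L2_of_flip_space w X : L2_of R w X -> exists2 xy, xy \in flip_pairs w & X = flip_space xy.
Proof.
move=> [[[S /subsetP Spos EX] dimX] sep].
have {}sep p : p \in positive_root n -> (X <= root_hyperplane p)%VS -> p \in inversions w.
  by move=> ppos Xp; apply/(separates_inversion _ ppos)/sep.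
have XS p : p \in S -> (X <= root_hyperplane p)%VS.
  by move=> pS; rewrite EX; apply: bigcapv_inf pS _.
have [p [q [pS qS pq]]] : exists p q, [/\ p \in S, q \in S & p != q].
  apply/card_gt1P; rewrite ltnNge; apply/negP => /card_le1P S1.
  have [S0|[p pS]] := set_0Vmem S.
    by move: dimX; rewrite EX S0 big_set0 dimvf dim_matrix [X in X + 2]mul1n; lia.
  have Sp : S = [set p]%SET by apply/setP => q; rewrite inE; apply: S1.
  by have := dim_root_hyperplane (Spos _ pS); move: dimX; rewrite EX Sp big_set1; lia.
have main (a b c d : 'I_n) : (a, b) \in S -> (c, d) \in S ->
    (b < d) || (b == d) && (a < c) -> exists2 xy, xy \in flip_pairs w & X = flip_space xy.
  move=> abS cdS lt; have [abpos cdpos] := (Spos _ abS, Spos _ cdS).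
  have [Xab Xcd] := (XS _ abS, XS _ cdS).
  have [abw cdw] := (sep _ abpos Xab, sep _ cdpos Xcd).
  have [ab cd] : a < b /\ c < d by move: abpos cdpos; rewrite !inE.
  have [ebd|nbd] := eqVneq b d.
    have ac : a < c by move: lt; rewrite ebd ltnn eqxx.
    have acpos : (a, c) \in positive_root n by rewrite inE.
    have Xac : (X <= root_hyperplane (a, c))%VS.
      apply/subvP => v vX; move: (subvP Xab v vX) (subvP Xcd v vX).
      by rewrite !mem_root_hyperplane /= ebd => /eqP-> /eqP->.
    exists ((a, c), (c, d)).
      by rewrite in_flip_pairs cdw (sep _ acpos Xac) /= cd -val_eqE /= ltn_eqF.
    by apply: codim2_eq_cap => //; rewrite xpair_eqE -val_eqE /= ltn_eqF.
  have bd : b < d by move: lt; rewrite (negbTE nbd) orbF.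
  have [eac|nac] := eqVneq a c.
    have bdpos : (b, d) \in positive_root n by rewrite inE.
    have Xbd : (X <= root_hyperplane (b, d))%VS.
      apply/subvP => v vX; move: (subvP Xab v vX) (subvP Xcd v vX).
      by rewrite !mem_root_hyperplane /= -eac => /eqP-> /eqP->.
    exists ((a, b), (b, d)).
      by rewrite in_flip_pairs abw (sep _ bdpos Xbd) /= bd -val_eqE /= ltn_eqF.
    by apply: codim2_eq_cap => //; rewrite xpair_eqE -val_eqE /= ltn_eqF.
  exists ((a, b), (c, d)); first by rewrite in_flip_pairs abw cdw bd.
  by apply: codim2_eq_cap => //; rewrite xpair_eqE (negbTE nac).
case: p q pS qS pq => [a b] [c d] pS qS; rewrite xpair_eqE -!val_eqE /= => neq.
have [lt|ge] := boolP ((b < d) || (b == d) && (a < c)); first exact: main pS qS lt.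
by apply: main qS pS _; move: ge neq; rewrite -!val_eqE /=; lia.
Qed.

Theorem card_L2_ofE w : card_L2_of R w = #|flip_pairs w|.
Proof.
rewrite /card_L2_of.
have -> : cardinality.fset_set (L2_of R w) = [fset flip_space xy | xy in flip_pairs w]%fset.
  apply/fsetP => X; rewrite cardinality.in_fset_set; last exact: finite_L2_of.
  apply/idP/imfsetP => [|[xy xyP ->]].
    by rewrite classical_sets.inE => /L2_of_flip_space.
  by rewrite classical_sets.inE; apply: flip_space_L2_of.
by rewrite card_in_imfset /= -?cardE //; apply: flip_space_inj.
Qed.

End Geometry.

(** * The equality case of the diameter bound *)

Theorem theorem1p2 (R : realType) (n : nat) (n_gt0 : (0 < n)%N) (w : 'S_n) :
  (2%:R^-1 * (card_L2_of R w)%:R = (diam_G w)%:R :> R)%R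
  <->
  exists (i j k l : nat) (e : (i + (j + k) + l)%N = n),
    w = cast_perm e
          (direct_sum
             (direct_sum (id_perm i) (skew_sum (id_perm j) (id_perm k)))
             (id_perm l)).
Proof.
have two_neq0 : (2%:R != 0 :> R)%R by rewrite pnatr_eq0.
have -> : (2%:R^-1 * (card_L2_of R w)%:R = (diam_G w)%:R :> R)%R <->
    #|flip_pairs w| = (diam_G w).*2.
  rewrite card_L2_ofE -muln2; split=> [e|->].
    by apply/eqP; rewrite -(eqr_nat R) natrM -e mulrC mulVKf.
  by rewrite natrM mulrC mulfK.
rewrite -biclique_block; split=> [e|bi]; first by apply: extremal_biclique; rewrite e.
by apply/eqP; rewrite eqn_leq half_flip_pairs_le_diam diam_le_half_flip_pairs.
Qed.
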